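(* Let $S$ be a Damek--Ricci space with $n=\dim\mathfrak v$, $m=\dim\mathfrak z$, in the half-space model. Let $h$ be the trace of the shape operator of a regular level hypersurface $\Sigma$ of one of the isoparametric functions $F=D_{x_0}$ or $F=D_{\circledast}^{\eta}$ on $S$, with respect to the unit normal $\mathbf N=\nabla F/\|\nabla F\|$. Then $$h=\begin{cases}-\frac{m+n}{2}\coth(r/2)-\frac m2\tanh(r/2)&\text{if }\Sigma\text{ is a sphere of radius }r,\\[4pt]-\left(m+\frac n2\right)&\text{if }\Sigma\text{ is a horosphere},\\[4pt]-\frac{m+n}{2}\tanh(r/2)-\frac m2\coth(r/2)&\text{if }\Sigma\text{ is a tube of radius }r\text{ about }\mathcal F_{x_0}\text{ with }x_0\in\mathfrak v\oplus\mathfrak z\times\mathbb R_-\text{ or about }\mathcal F_{\circledast}^{\eta}.\end{cases}$$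
   Context: Damek--Ricci space: let $\mathfrak s=\mathfrak v\oplus\mathfrak z\oplus\mathfrak a$ be an orthogonal decomposition of a finite-dimensional Euclidean space $(\mathfrak s,\langle\,,\rangle)$ with $\mathfrak a=\mathbb RA$, $\|A\|=1$, $n=\dim\mathfrak v$, $m=\dim\mathfrak z$ (either may be $0$). Let $J$ be a representation on $\mathfrak v$ of the Clifford algebra $\mathrm{Cl}(\mathfrak z,q)$ of $q(Z)=-\langle Z,Z\rangle$ with $\|J_ZV\|=\|Z\|\|V\|$. The Lie bracket on $\mathfrak s$ is determined by $\langle[U,V],Z\rangle=\langle J_ZU,V\rangle$ with $[U,V]\in\mathfrak z$ for $U,V\in\mathfrak v$, $Z\in\mathfrak z$; $[\mathfrak v\oplus\mathfrak z,\mathfrak z]=0$; $[A,V]=\frac12V$ for $V\in\mathfrak v$; $[A,Z]=Z$ for $Z\in\mathfrak z$. The simply connected Lie group $S$ with Lie algebra $\mathfrak s$ and the left-invariant metric induced by $\langle\,,\rangle$ is the Damek--Ricci space. Half-space model: $S$ is identified with $\mathfrak v\oplus\mathfrak z\times\mathbb R_+\subset\mathfrak v\oplus\mathfrak z\oplus\mathbb R$ via $(V,Z,t)\mapsto\exp(V+Z)\exp((\ln t)A)$; $\mathbb R_-$ denotes the negative reals. For $x_0=(V_0,Z_0,t_0)\in\mathfrak v\oplus\mathfrak z\oplus\mathbb R$: $D_{x_0}((V,Z,t))=\frac1t\left(\left(t+t_0+\left\|\frac{V-V_0}{2}\right\|^2\right)^2+\left\|Z-Z_0+\frac12[V,V_0]\right\|^2\right)$.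 Its regular level sets are the geodesic spheres about $x_0$ if $t_0>0$, horospheres if $t_0=0$, and if $t_0<0$ the tubes about $\mathcal F_{x_0}=D_{x_0}^{-1}(0)=\{(V,Z,t)\in S:\|V-V_0\|^2=-4(t+t_0),\ Z=Z_0-\frac12[V,V_0]\}$. For $(\bar V,\bar Z,\bar t)\in S$ and $v\in\mathfrak v$, $s\in\mathbb R$ with $\|v\|^2+s^2=1$ (these data encode the left translate $\eta$ by $(\bar V,\bar Z,\bar t)$ of the prolonged geodesic from $e$ with initial velocity $(v,0,s)$): $D_{\circledast}^{\eta}(V,Z,t)=\frac1t\left((2s\sqrt{\bar t}-\langle V-\bar V,v\rangle)^2+\|[V-\bar V,v]\|^2\right)$. If $v\neq0$, its regular level sets are the tubes about $\mathcal F_{\circledast}^{\eta}=\{(V,Z,t)\in S:[V-\bar V,v]=0,\ \langle V-\bar V,v\rangle=2s\sqrt{\bar t}\}$; if $v=0$, they are horospheres. The tube of radius $r>0$ about a submanifold is the set of points of $S$ at distance $r$ from it. The shape operator with respect to a unit normal field $\mathbf N$ is $X\mapsto-\nabla_X\mathbf N$; the mean curvature is $h/\dim\Sigma$. *)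

(* Defs.v *)
From HB Require Import structures.
From mathcomp Require Import all_boot all_order all_algebra.
From mathcomp Require Import all_classical all_reals all_analysis.

Set Implicit Arguments.
Unset Strict Implicit.
Unset Printing Implicit Defensive.

Import Order.TTheory GRing.Theory Num.Theory.
Import numFieldNormedType.Exports.

Local Open Scope classical_set_scope.
Local Open Scope ring_scope.

(* Euclidean inner product and norm of row vectors; the library norm `|x| on
   matrices is the sup norm and is used only through the topology. *)
Definition dot (R : realType) (k : nat) (x y : 'rV[R]_k) : R :=
  \sum_(i < k) x 0 i * y 0 i.

Definition enorm (R : realType) (k : nat) (x : 'rV[R]_k) : R :=
  Num.sqrt (dot x x).

Definition cosh (R : realType) (x : R) : R := (expR x + expR (- x)) / 2.
Definition sinh (R : realType) (x : R) : R := (expR x - expR (- x)) / 2.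
Definition tanh (R : realType) (x : R) : R := sinh x / cosh x.
Definition coth (R : realType) (x : R) : R := cosh x / sinh x.

(* Riemannian geometry of a metric g given in coordinates on an open subset of
   R^d: g p X Y is the inner product of the tangent vectors X and Y at p. *)
Section Riemannian.
Context (R : realType) (d : nat).
Local Notation E := 'rV[R]_d.
Variable g : E -> E -> E -> R.

Local Notation "''e_' i" := (delta_mx 0 i : E) (at level 8, i at level 2).

Definition gram (p : E) : 'M[R]_d := \matrix_(i, j) g p 'e_i 'e_j.

(* The Christoffel term of the Levi-Civita connection,
   1/2 g^{kl} (X^i d_i g_jl Y^j + Y^j d_j g_il X^i - d_l g_ij X^i Y^j). *)
Definition christoffel (p X Y : E) : E :=
  (2^-1 *: \row_l ('D_X (fun q => g q Y 'e_l) p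
                 + 'D_Y (fun q => g q X 'e_l) p
                 - 'D_'e_l (fun q => g q X Y) p)) *m invmx (gram p).

Definition nabla (p X : E) (N : E -> E) : E := 'D_X N p + christoffel p X (N p).

Definition dform (F : E -> R) (p : E) : E := \row_i 'D_'e_i F p.

Definition grad (F : E -> R) (p : E) : E := dform F p *m invmx (gram p).

Definition unit_normal (F : E -> R) (p : E) : E :=
  (Num.sqrt (g p (grad F p) (grad F p)))^-1 *: grad F p.

(* Row space: the tangent space at p of the level set of F through p. *)
Definition level_tangent (F : E -> R) (p : E) : 'M[R]_d := kermx (dform F p)^T.

(* Matrix, acting on row vectors from the right, of X |-> - nabla_X N. *)
Definition shape_mx (F : E -> R) (p : E) : 'M[R]_d :=
  lin1_mx (fun X => - nabla p X (unit_normal F)).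

(* Trace of the restriction of the shape operator to the tangent space, which
   is invariant because the normal has unit length. *)
Definition shape_trace (F : E -> R) (p : E) : R :=
  \tr (conjmx (row_base (level_tangent F p)) (shape_mx F p)).

Variable M : set E.

Definition level (F : E -> R) (c : R) : set E := [set p | M p /\ F p = c].

Definition regular_value (F : E -> R) (c : R) : Prop :=
  forall p, level F c p -> grad F p != 0.

(* C^1 curves parametrized on [0, 1]. Each of them extends to a C^1 map on R,
   so asking for differentiability on all of R is no restriction. Vanishing
   velocity is allowed, so piecewise C^1 curves yield the same infimum. *)
Definition curve_from_to (p q : E) (c : R -> E) : Prop :=
  [/\ forall u, derivable c u 1, continuous (derive1 c),
      forall u, 0 <= u <= 1 -> M (c u), c 0 = p & c 1 = q].

Definition curve_length (c : R -> E) : R :=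
  \int[lebesgue_measure]_(u in `[0, 1])
    Num.sqrt (g (c u) (derive1 c u) (derive1 c u)).

Definition dist (p q : E) : R :=
  inf [set curve_length c | c in curve_from_to p q].

Definition dist_set (p : E) (A : set E) : R := inf [set dist p q | q in A].

Definition sphere (p : E) (r : R) : set E := [set q | M q /\ dist q p = r].

Definition tube (A : set E) (r : R) : set E :=
  [set q | M q /\ dist_set q A = r].

End Riemannian.

Section DamekRicci.
Context (R : realType) (n m : nat).

(* A representation of Cl(R^m, -|.|^2) on R^n, given (universal property) by a
   linear map J with J_Z^2 = -|Z|^2. J_Z V is V *m J Z. *)
Definition clifford_rep (J : {linear 'rV[R]_m -> 'M[R]_n}) : Prop :=
  (forall Z, J Z *m J Z = (- dot Z Z)%:M) /\
  (forall Z V, enorm (V *m J Z) = enorm Z * enorm V).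

Variable J : {linear 'rV[R]_m -> 'M[R]_n}.

Definition bracket (U V : 'rV[R]_n) : 'rV[R]_m :=
  \row_k dot (U *m J (delta_mx 0 k)) V.

Lemma bracketP (U V : 'rV[R]_n) (Z : 'rV[R]_m) :
  dot (bracket U V) Z = dot (U *m J Z) V.
Proof.
rewrite [in RHS](row_sum_delta Z) linear_sum mulmx_sumr /dot.
under [RHS]eq_bigr do rewrite summxE mulr_suml.
rewrite [RHS]exchange_big /=; apply: eq_bigr => k _.
rewrite mxE /dot mulr_suml; apply: eq_bigr => i _.
by rewrite linearZ /= -scalemxAr [in RHS]mxE mulrC mulrA.
Qed.

Local Notation E := 'rV[R]_(n + m + 1).

Definition point (V : 'rV[R]_n) (Z : 'rV[R]_m) (t : R) : E :=
  row_mx (row_mx V Z) t%:M.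
Definition vpart (p : E) : 'rV[R]_n := lsubmx (lsubmx p).
Definition zpart (p : E) : 'rV[R]_m := rsubmx (lsubmx p).
Definition tpart (p : E) : R := rsubmx p 0 0.

Definition drspace : set E := [set p | 0 < tpart p].

(* The group law of S transported to the half-space by
   (V, Z, t) |-> exp(V + Z) exp((ln t) A): conjugation by exp((ln t) A) acts on
   v by t^(1/2) and on z by t, and exp(V + Z) exp(V' + Z') =
   exp(V + V' + Z + Z' + [V, V'] / 2). *)
Definition mulS (p q : E) : E :=
  point (vpart p + Num.sqrt (tpart p) *: vpart q)
        (zpart p + tpart p *: zpart q
           + (Num.sqrt (tpart p) / 2) *: bracket (vpart p) (vpart q))
        (tpart p * tpart q).

Definition oneS : E := point 0 0 1.

Definition invS (p : E) : E :=
  point (- (Num.sqrt (tpart p))^-1 *: vpart p)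
        (- (tpart p)^-1 *: zpart p) (tpart p)^-1.

(* The left-invariant metric: T_pS is carried to the tangent space at oneS, that
   is, v + z + R A with its Euclidean product, by the differential at p of the
   left translation by p^-1. *)
Definition metricS (p X Y : E) : R :=
  dot ('D_X (mulS (invS p)) p) ('D_Y (mulS (invS p)) p).

Definition Dpt (x0 p : E) : R :=
  (tpart p)^-1 *
  ((tpart p + tpart x0 + enorm (2^-1 *: (vpart p - vpart x0)) ^+ 2) ^+ 2
   + enorm (zpart p - zpart x0 + 2^-1 *: bracket (vpart p) (vpart x0)) ^+ 2).

Definition Fpt (x0 : E) : set E := level drspace (Dpt x0) 0.

(* a = (Vbar, Zbar, tbar) *)
Definition Dstar (a : E) (v : 'rV[R]_n) (s : R) (p : E) : R :=
  (tpart p)^-1 *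
  ((2 * s * Num.sqrt (tpart a) - dot (vpart p - vpart a) v) ^+ 2
   + enorm (bracket (vpart p - vpart a) v) ^+ 2).

Definition Fstar (a : E) (v : 'rV[R]_n) (s : R) : set E :=
  [set p | [/\ drspace p, bracket (vpart p - vpart a) v = 0 &
               dot (vpart p - vpart a) v = 2 * s * Num.sqrt (tpart a)]].

End DamekRicci.

Arguments drspace {R n m} _.

(* Main.v *)
Require Import Defs.
From HB Require Import structures.
From mathcomp Require Import all_boot all_order all_algebra.
From mathcomp Require Import all_classical all_reals all_analysis.
From mathcomp Require Import ring lra.
Import Order.TTheory GRing.Theory Num.Theory.
Import numFieldNormedType.Exports.
Local Open Scope classical_set_scope.
Local Open Scope ring_scope.

(** The metric at a point p with last coordinate t > 0 is the Euclidean one pulled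
back by a matrix B(p), the left-invariant coframe, which is block triangular
with diagonal t^(-1/2), t^(-1), t^(-1).  For a metric of this kind the trace of
the shape operator of a level hypersurface with unit normal field N is minus the
divergence of N, namely - (sum_i d_i N^i + tr (B^(-1) d_N B))
([shape_trace_div]), and here tr (B^(-1) d_N B) = - (n/2 + m + 1) N^t / t
([coframe_trace]).

Both families of functions satisfy, for a constant kappa, the two equations
  |grad F|^2 = F^2 + 4 kappa F,
  Laplacian F = (n/2 + m + 1) F + 2 kappa (m + 1),
with kappa = - t_0 for D_x0 and kappa = |v|^2 for the function attached to a
geodesic ([isoparametric_Dpt], [isoparametric_Dstar]); this is where the
Clifford relations enter, through J_Z being skew and |J_Z V| = |Z||V|.  Hence
the trace of the shape operator is a function of the value of F only,
  h = - ((m + n/2) F + 2 kappa m) / sqrt (F^2 + 4 kappa F)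
([shape_trace_isoparametric]).  For kappa = 0 this is the constant of the
horospheres.

For kappa <> 0 the value of F has to be expressed by the radius.  Put
y = F + 2 kappa and k = 2 |kappa|.  Then |grad y|^2 = y^2 - k^2 and y >= k, with
equality exactly on the centre of the sphere or on the focal submanifold of the
tube, so arcosh (y / k) should be the distance to that set.  Along a curve,
ln (y + sqrt (y^2 - k^2)) varies at most as fast as arc length, by the
Cauchy-Schwarz inequality; this bounds all distances from below
([curve_length_ge], [dist_ge]).  For the opposite bound one curve is enough:
since the hypothesis identifies the whole level set with a sphere or tube, the
radius can be read off at a single well chosen point of the level set, from
which a minimizing geodesic is explicit - a vertical line ([vertical_curve]) or
a half circle of the hyperbolic plane spanned by v and A
([half_circle_curve]).  This yields y = k cosh r, and the half-angle formulas
turn h into the stated expressions. *)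

Local Notation point := Defs.point.

(** * Directional derivatives of matrix-valued maps *)

Section Calculus.
Context {R : realType} {V : normedModType R}.
Implicit Types (x w : V).

(** The rules of this part are stated for a map on an arbitrary normed module,
so that the same computation gives both partial derivatives on the half-space
and derivatives along curves. *)
Lemma is_derive_mxP {k l : nat} {M : V -> 'M[R]_(k, l)} {x w} {dM : 'M[R]_(k, l)} :
  is_derive x w M dM <->
  forall i j, is_derive x w (fun y => M y i j) (dM i j).
Proof.
split=> [[dMx <-] i j|H].
  rewrite derive_mx// mxE.
  exact/derivableP/(iffLR (derivable_mxP M x w) dMx).
have dMx : derivable M x w by apply/derivable_mxP => i j; case: (H i j).
split=> //; rewrite derive_mx//; apply/matrixP => i j; rewrite mxE.
by case: (H i j).
Qed.

Lemma is_derive_ext {W : normedModType R} {f g : V -> W} {x w : V} {df dg : W} :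
  is_derive x w f df -> f =1 g -> df = dg -> is_derive x w g dg.
Proof. by move=> fx /funext <- <-. Qed.

Lemma is_derive_fsum {W : normedModType R} {l : nat} {h : 'I_l -> V -> W} {x w}
    {dh : 'I_l -> W} :
  (forall i, is_derive x w (h i) (dh i)) ->
  is_derive x w (fun y => \sum_i h i y) (\sum_i dh i).
Proof.
move=> H; have HS : is_derive x w (\sum_i h i) (\sum_i dh i) by exact: is_derive_sum.
apply: (is_derive_ext HS) => // y.
by rewrite fct_sumE.
Qed.

Lemma is_derive_add {W : normedModType R} {f g : V -> W} {x w df dg} :
  is_derive x w f df -> is_derive x w g dg ->
  is_derive x w (fun y => f y + g y) (df + dg).
Proof. by move=> Hf Hg; apply: (is_derive_ext (is_deriveD Hf Hg)). Qed.

Lemma is_derive_opp {W : normedModType R} {f : V -> W} {x w df} :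
  is_derive x w f df -> is_derive x w (fun y => - f y) (- df).
Proof. by move=> Hf; apply: (is_derive_ext (is_deriveN Hf)). Qed.

Lemma is_derive_mul {f g : V -> R} {x w} {df dg : R} :
  is_derive x w f df -> is_derive x w g dg ->
  is_derive x w (fun y => f y * g y) (df * g x + f x * dg).
Proof.
move=> Hf Hg; apply: (is_derive_ext (is_deriveM Hf Hg)) => //.
by rewrite addrC; congr (_ + _); rewrite mulrC.
Qed.

Lemma is_derive_sqr {f : V -> R} {x w} {df : R} :
  is_derive x w f df -> is_derive x w (fun y => f y ^+ 2) (2 * f x * df).
Proof.
move=> Hf; apply: (is_derive_ext (is_derive_mul Hf Hf)) => [y|]; first by rewrite expr2.
by ring.
Qed.

Lemma is_derive_inv {f : V -> R} {x w} {df : R} :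
  is_derive x w f df -> f x != 0 -> is_derive x w (fun y => (f y)^-1) (- df / f x ^+ 2).
Proof.
move=> [fx <-] f0; split; first exact: derivableV.
by rewrite deriveV// -[_ *: _]/(_ * _) mulrC mulrN mulNr.
Qed.

Lemma is_derive_mulmx {k l q : nat} {M : V -> 'M[R]_(k, l)} {N : V -> 'M[R]_(l, q)}
    {x w} {dM dN} :
  is_derive x w M dM -> is_derive x w N dN ->
  is_derive x w (fun y => M y *m N y) (dM *m N x + M x *m dN).
Proof.
move=> /is_derive_mxP HM /is_derive_mxP HN; apply/is_derive_mxP => i j.
apply: (is_derive_ext (is_derive_fsum (fun h => is_derive_mul (HM i h) (HN h j)))).
  by move=> y; rewrite mxE.
by rewrite !mxE -big_split.
Qed.

Lemma is_derive_tr {k l : nat} {M : V -> 'M[R]_(k, l)} {x w} {dM} :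
  is_derive x w M dM -> is_derive x w (fun y => (M y)^T) (dM^T).
Proof.
move=> /is_derive_mxP HM; apply/is_derive_mxP => i j.
by apply: (is_derive_ext (HM j i)) => [y|]; rewrite mxE.
Qed.

Lemma is_derive_scale {k l : nat} {f : V -> R} {M : V -> 'M[R]_(k, l)} {x w df dM} :
  is_derive x w f df -> is_derive x w M dM ->
  is_derive x w (fun y => f y *: M y) (df *: M x + f x *: dM).
Proof.
move=> Hf /is_derive_mxP HM; apply/is_derive_mxP => i j.
by apply: (is_derive_ext (is_derive_mul Hf (HM i j))) => [y|]; rewrite !mxE.
Qed.

Lemma is_derive_linmx {k l k' l' : nat} (L : {linear 'M[R]_(k, l) -> 'M[R]_(k', l')})
    {M : V -> 'M[R]_(k, l)} {x w dM} :
  is_derive x w M dM -> is_derive x w (fun y => L (M y)) (L dM).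
Proof.
move=> /is_derive_mxP HM; apply/is_derive_mxP => a b.
(* A linear map between matrix spaces is a finite combination of entries. *)
have LE A : L A a b = \sum_i \sum_j A i j * L (delta_mx i j) a b.
  rewrite [in LHS](matrix_sum_delta A) linear_sum summxE; apply: eq_bigr => i _.
  rewrite linear_sum summxE; apply: eq_bigr => j _.
  by rewrite linearZ mxE.
have H : forall i, is_derive x w (fun y => \sum_j M y i j * L (delta_mx i j) a b)
   (\sum_j (dM i j * L (delta_mx i j) a b + M x i j * 0)).
  move=> i; apply: is_derive_fsum => j.
  have Hc : is_derive x w (fun=> L (delta_mx i j) a b) (0 : R) by apply: is_derive_cst.
  exact: (is_derive_mul (HM i j) Hc).
apply: (is_derive_ext (is_derive_fsum H)) => [y|]; first by rewrite LE.
rewrite LE; apply: eq_bigr => i _; apply: eq_bigr => j _.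
by rewrite mulr0 addr0.
Qed.

(** A directional derivative is the derivative at 0 of the restriction to a
line, which reduces the chain rule to functions of one variable. *)
Lemma is_derive_chain {f : V -> R} {h : R -> R} {x w} {df dh : R} :
  is_derive x w f df -> is_derive (f x) 1 h dh ->
  is_derive x w (fun y => h (f y)) (df * dh).
Proof.
move=> [fx fE] hx.
pose f1 (s : R) := f (s *: w + x).
have E0 (k : V -> R) : 'D_1 (fun s : R => k (s *: w + x)) 0 = 'D_w k x.
  rewrite /derive.
  set g1 := fun h => h^-1 *: _; set g2 := fun h => h^-1 *: _.
  suff -> : g1 = g2 by [].
  by rewrite funeqE /g1 /g2 => s /=; rewrite addr0 scale0r add0r [_%:A]mulr1.
have F1 : is_derive (0:R) 1 f1 df.
  split; first exact: (derivable1P _ _ _).1 fx.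
  by rewrite /f1 E0.
have H1 : is_derive (f1 0) 1 h dh by rewrite /f1 scale0r add0r.
have [H H'] : is_derive (0:R) 1 (h \o f1) (dh * df) by apply: is_derive1_comp.
split; first by apply: (derivable1P _ _ _).2; exact: H.
by rewrite -E0 [LHS]H' /= mulrC.
Qed.

Lemma is_derive_sqrt {f : V -> R} {x w} {df : R} :
  is_derive x w f df -> 0 < f x ->
  is_derive x w (fun y => Num.sqrt (f y)) (df / (2 * Num.sqrt (f x))).
Proof. by move=> Hf f0; exact: (is_derive_chain Hf (is_derive1_sqrt f0)). Qed.

End Calculus.

(** * Euclidean product, and metrics given by a coframe *)

Section Dot.
Context {R : realType}.

Lemma dotE {k} (x y : 'rV[R]_k) : dot x y = (x *m y^T) 0 0.
Proof. by rewrite mxE; apply: eq_bigr => i _; rewrite mxE. Qed.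

Lemma dotC {k} (x y : 'rV[R]_k) : dot x y = dot y x.
Proof. by apply: eq_bigr => i _; rewrite mulrC. Qed.

Lemma dotDl {k} (x y z : 'rV[R]_k) : dot (x + y) z = dot x z + dot y z.
Proof. by rewrite !dotE mulmxDl mxE. Qed.

Lemma dotZl {k} a (x y : 'rV[R]_k) : dot (a *: x) y = a * dot x y.
Proof. by rewrite !dotE -scalemxAl mxE. Qed.

Lemma dotDr {k} (x y z : 'rV[R]_k) : dot x (y + z) = dot x y + dot x z.
Proof. by rewrite dotC dotDl !(dotC x). Qed.

Lemma dotZr {k} a (x y : 'rV[R]_k) : dot x (a *: y) = a * dot x y.
Proof. by rewrite dotC dotZl dotC. Qed.

Lemma dotNl {k} (x y : 'rV[R]_k) : dot (- x) y = - dot x y.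
Proof. by rewrite -scaleN1r dotZl mulN1r. Qed.

Lemma dotNr {k} (x y : 'rV[R]_k) : dot x (- y) = - dot x y.
Proof. by rewrite dotC dotNl dotC. Qed.

Lemma dot0l {k} (x : 'rV[R]_k) : dot 0 x = 0.
Proof. by rewrite -(scale0r 0) dotZl mul0r. Qed.

Lemma dot0r {k} (x : 'rV[R]_k) : dot x 0 = 0.
Proof. by rewrite dotC dot0l. Qed.

Lemma dot_ge0 {k} (x : 'rV[R]_k) : 0 <= dot x x.
Proof. by apply: sumr_ge0 => i _; rewrite -expr2 sqr_ge0. Qed.

Lemma dot_eq0 {k} (x : 'rV[R]_k) : (dot x x == 0) = (x == 0).
Proof.
apply/idP/eqP => [|->]; last by rewrite dot0l.
rewrite psumr_eq0 => [/allP H|i _]; last by rewrite -expr2 sqr_ge0.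
apply/rowP => i; rewrite mxE; apply/eqP.
by have := H i; rewrite mem_index_enum mulf_eq0 orbb; apply.
Qed.

Lemma enorm_sqr {k} (x : 'rV[R]_k) : enorm x ^+ 2 = dot x x.
Proof. by rewrite /enorm sqr_sqrtr// dot_ge0. Qed.

Lemma dot_delta {k} (x : 'rV[R]_k) i : dot x (delta_mx 0 i) = x 0 i.
Proof.
rewrite /dot (bigD1 i)//= big1 ?addr0 => [|j ji]; first by rewrite !mxE !eqxx mulr1.
by rewrite !mxE (negPf ji) andbF mulr0.
Qed.

Lemma dot_mulmx {k l} (x : 'rV[R]_k) (A : 'M[R]_(k, l)) y :
  dot (x *m A) y = dot x (y *m A^T).
Proof. by rewrite !dotE trmx_mul trmxK mulmxA. Qed.

(** Expanding the square of the component of x orthogonal to y. *)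
Lemma dot_CS {k} (x y : 'rV[R]_k) : dot x y ^+ 2 <= dot x x * dot y y.
Proof.
have [->|y0] := eqVneq y 0; first by rewrite !dot0r expr0n mulr0.
have yy : 0 < dot y y by rewrite lt_def dot_ge0 dot_eq0 y0.
have := dot_ge0 (dot y y *: x - dot x y *: y).
rewrite dotDl !dotDr !dotNl !dotNr !dotZl !dotZr (dotC y x).
set a := dot x x; set b := dot x y; set c := dot y y => H.
rewrite -subr_ge0 -(pmulr_rge0 _ yy).
suff -> : dot y y * (a * c - b ^+ 2) = c * (c * a) - c * (b * b) + (- (b * (c * b)) - - (b * (b * c))) by [].
by rewrite -/c; ring.
Qed.

Lemma is_derive_dot {V : normedModType R} {k} {f g : V -> 'rV[R]_k} {x w df dg} :
  is_derive x w f df -> is_derive x w g dg ->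
  is_derive x w (fun y => dot (f y) (g y)) (dot df (g x) + dot (f x) dg).
Proof.
move=> Hf Hg; have /is_derive_mxP H := is_derive_mulmx Hf (is_derive_tr Hg).
apply: (is_derive_ext (H 0 0)) => [y|]; first by rewrite dotE.
by rewrite !dotE mxE.
Qed.

End Dot.

Lemma gram_coframe {R : realType} {d : nat}
    {g : 'rV[R]_d -> 'rV[R]_d -> 'rV[R]_d -> R} {B : 'M[R]_d} {p : 'rV[R]_d} :
  (forall X Y, g p X Y = dot (X *m B) (Y *m B)) -> gram g p = B *m B^T.
Proof.
move=> gE; apply/matrixP => i j; rewrite mxE gE -!rowE [RHS]mxE.
by apply: eq_bigr => k _; rewrite !mxE.
Qed.

Section Coframe.
Context {R : realType} {d : nat}.
Local Notation E := 'rV[R]_d.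
Local Notation "''e_' i" := (delta_mx 0 i : E) (at level 8, i at level 2).
Context {g : E -> E -> E -> R} {B : E -> 'M[R]_d} {p : E}
  {dB : E -> 'M[R]_d}.
Hypothesis gE : \near p, forall X Y, g p X Y = dot (X *m B p) (Y *m B p).
Hypothesis dBP : forall X, is_derive p X B (dB X).
Hypothesis dB_lin : forall Y, dB Y = \sum_i Y 0 i *: dB 'e_i.
Hypothesis Bu : B p \in unitmx.

Let gEp X Y : g p X Y = dot (X *m B p) (Y *m B p).
Proof. exact: nbhs_singleton gE X Y. Qed.

Let gram_unit : gram g p \in unitmx.
Proof. by rewrite (gram_coframe gEp) unitmx_mul Bu unitmx_tr. Qed.

Let g_gram X Y : g p X Y = dot (X *m gram g p) Y.
Proof. by rewrite gEp (gram_coframe gEp) mulmxA [RHS]dot_mulmx trmxK. Qed.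

Let dmetric X Y Z : 'D_X (fun q => g q Y Z) p =
  dot (Y *m dB X) (Z *m B p) + dot (Y *m B p) (Z *m dB X).
Proof.
have H (Y' : E) : is_derive p X (fun q => Y' *m B q) (Y' *m dB X).
  by apply: (is_derive_ext (is_derive_mulmx (is_derive_cst Y' p X) (dBP X))) => //; rewrite mul0mx add0r.
have [_ <-] := is_derive_dot (H Y) (H Z).
by apply: near_eq_derive; near=> q; apply: (near gE q).
Unshelve. all: by end_near. Qed.

Lemma christoffel_gram X Y l :
  (christoffel g p X Y *m gram g p) 0 l = 2^-1 *
  ('D_X (fun q => g q Y 'e_l) p + 'D_Y (fun q => g q X 'e_l) p
   - 'D_'e_l (fun q => g q X Y) p).
Proof. by rewrite /christoffel -mulmxA mulVmx// mulmx1 !mxE. Qed.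

(** Metric compatibility of the connection, on the diagonal: the last two
terms of the Christoffel symbol cancel when it is paired with Y. *)
Lemma christoffel_metric X Y :
  g p (christoffel g p X Y) Y = dot (Y *m dB X) (Y *m B p).
Proof.
rewrite g_gram /dot.
under eq_bigr do rewrite christoffel_gram !dmetric -mulrA [_ * Y _ _]mulrDl mulrDl mulNr.
rewrite -mulr_sumr !big_split /= sumrN.
have S1 (f : E -> R) : (forall a Z Z', f (a *: Z + Z') = a * f Z + f Z') ->
   \sum_i f 'e_i * Y 0 i = f Y.
  move=> fl; have f0 : f 0 = 0.
    by have := fl 1 0 0; rewrite scale1r addr0 mul1r => /(congr1 (fun z => z - f 0)); rewrite addrK subrr.
  rewrite [in RHS](row_sum_delta Y).
  rewrite (big_morph f (id1 := 0) (op1 := +%R)) // => [|u v]; last first.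
    by have := fl 1 u v; rewrite scale1r mul1r.
  by apply: eq_bigr => i _; have := fl (Y 0 i) 'e_i 0; rewrite addr0 f0 addr0 mulrC.
rewrite (S1 (fun Z => dot (Y *m dB X) (Z *m B p) + dot (Y *m B p) (Z *m dB X))); last first.
  by move=> a Z Z'; rewrite !mulmxDl -!scalemxAl !dotDr !dotZr; ring.
rewrite (S1 (fun Z => dot (X *m dB Y) (Z *m B p) + dot (X *m B p) (Z *m dB Y))); last first.
  by move=> a Z Z'; rewrite !mulmxDl -!scalemxAl !dotDr !dotZr; ring.
have -> : \sum_i (dot (X *m dB 'e_i) (Y *m B p) + dot (X *m B p) (Y *m dB 'e_i)) * Y 0 i
   = dot (X *m dB Y) (Y *m B p) + dot (X *m B p) (Y *m dB Y).
  rewrite (dB_lin Y) !mulmx_sumr.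
  rewrite (big_morph (fun z => dot z (Y *m B p)) (id1 := 0) (op1 := +%R)) ?dot0l //; last first.
    by move=> ? ?; rewrite dotDl.
  rewrite (big_morph (dot (X *m B p)) (id1 := 0) (op1 := +%R)) ?dot0r //; last first.
    by move=> ? ?; rewrite dotDr.
  rewrite -big_split; apply: eq_bigr => i _ /=.
  by rewrite -!scalemxAr dotZl dotZr; ring.
rewrite (dotC (Y *m B p)) addrK -[RHS]/(dot (Y *m dB X) (Y *m B p)); by field.
Qed.

(** The first and third terms of the Christoffel symbol form an antisymmetric
matrix, whose trace against the symmetric inverse Gram matrix vanishes; the
middle term is half the logarithmic derivative of det (B B^T). *)
Lemma christoffel_trace Y :
  \sum_i christoffel g p 'e_i Y 0 i = \tr (invmx (B p) *m dB Y).
Proof.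
pose C := \matrix_(i, l) 'D_'e_i (fun q => g q Y 'e_l) p.
pose D := B p *m (dB Y)^T + dB Y *m (B p)^T.
have E1 : \sum_i christoffel g p 'e_i Y 0 i =
    \tr ((2^-1 *: (C - C^T + D)) *m invmx (gram g p)).
  apply: eq_bigr => i _.
  have -> : christoffel g p 'e_i Y = row i (2^-1 *: (C - C^T + D)) *m invmx (gram g p).
    rewrite /christoffel; congr (_ *m _); apply/rowP => l; rewrite !mxE addrAC; congr (_ * (_ + _ - _)).
      rewrite dmetric -!rowE addrC; congr (_ + _).
        by apply: eq_bigr => k _; rewrite !mxE.
      by apply: eq_bigr => k _; rewrite !mxE.
    by rewrite !dmetric addrC; congr (_ + _); rewrite dotC.
  by rewrite -row_mul mxE.
rewrite {}E1 -scalemxAl mxtraceZ.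
have sG : (invmx (gram g p))^T = invmx (gram g p).
  by rewrite trmx_inv (gram_coframe gEp) trmx_mul trmxK.
rewrite !mulmxDl !raddfD /= mulNmx raddfN /=.
have -> : \tr (C^T *m invmx (gram g p)) = \tr (C *m invmx (gram g p)).
  by rewrite -mxtrace_tr trmx_mul trmxK sG mxtrace_mulC.
rewrite subrr add0r.
have iG : invmx (gram g p) = (invmx (B p))^T *m invmx (B p).
  apply: (row_free_inj (A := gram g p)); first by rewrite row_free_unit.
  rewrite mulVmx// (gram_coframe gEp) mulmxA -(mulmxA _ _ (B p)) mulVmx// mulmx1.
  by rewrite -trmx_mul mulmxV// trmx1.
have T1 : \tr (B p *m (dB Y)^T *m invmx (gram g p)) = \tr (invmx (B p) *m dB Y).
  rewrite iG -mxtrace_tr !trmx_mul !trmxK mxtrace_mulC !mulmxA.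
  rewrite -(mulmxA _ (B p)^T) -trmx_mul.
  rewrite mulVmx// trmx1 mulmx1 mxtrace_mulC //.
have T2 : \tr (dB Y *m (B p)^T *m invmx (gram g p)) = \tr (invmx (B p) *m dB Y).
  rewrite iG !mulmxA -(mulmxA _ (B p)^T) -trmx_mul mulVmx// trmx1 mulmx1.
  by rewrite mxtrace_mulC.
by rewrite T1 T2; field.
Qed.

(** Since N has constant length, nabla_X N is orthogonal to N for every X, so
the endomorphism X |-> - nabla_X N of the whole tangent space has its image in
the tangent space of the level set; its trace is then that of its restriction,
and equals minus the divergence of N. *)
Lemma shape_trace_div (F : E -> R) (dN : E -> E) :
  (forall i, is_derive p 'e_i (unit_normal g F) (dN 'e_i)) ->
  (forall i, is_derive p 'e_i
     (fun q => g q (unit_normal g F q) (unit_normal g F q)) 0) ->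
  unit_normal g F p != 0 ->
  shape_trace g F p =
    - (\sum_i dN 'e_i 0 i + \tr (invmx (B p) *m dB (unit_normal g F p))).
Proof.
move=> HN HgN; set N := unit_normal g F in HN HgN * => N0.
pose S := shape_mx g F p.
have SE i j : S i j = - (dN 'e_i 0 j + christoffel g p 'e_i (N p) 0 j).
  by rewrite /S /shape_mx mxE /nabla (@derive_val _ _ _ _ _ _ _ (HN i)) !mxE.
have rowS i : row i S = - (dN 'e_i + christoffel g p 'e_i (N p)).
  by apply/rowP => j; rewrite mxE SE !mxE.
have normal i : g p (dN 'e_i + christoffel g p 'e_i (N p)) (N p) = 0.
  have HB : is_derive p 'e_i (fun q => N q *m B q) (dN 'e_i *m B p + N p *m dB 'e_i).
    exact: is_derive_mulmx.
  have [_ H0] := is_derive_dot HB HB.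
  have H1 : 'D_'e_i (fun q => dot (N q *m B q) (N q *m B q)) p = 0.
    have [_ <-] := HgN i; apply: near_eq_derive; near=> q.
    by rewrite -(near gE q).
  move: H0; rewrite H1 (dotC (N p *m B p)) -mulr2n => /esym/eqP.
  rewrite mulrn_eq0 /= dotDl => /eqP <-.
  have gDl X Y Z : g p (X + Y) Z = g p X Z + g p Y Z by rewrite !gEp mulmxDl dotDl.
  by rewrite gDl christoffel_metric gEp.
(* The differential of F is a multiple of the covector dual to N. *)
have [mu NE] : exists mu, dform F p = mu *: N p *m gram g p.
  pose l := (Num.sqrt (g p (grad g F p) (grad g F p)))^-1.
  have NE : N p = l *: grad g F p by [].
  have l0 : l != 0 by apply: contraNneq N0 => l0; rewrite NE l0 scale0r.
  exists l^-1; rewrite NE scalerA mulVf// scale1r.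
  by rewrite /grad mulmxKV.
have SdF : S *m (dform F p)^T = 0.
  apply/row_matrixP => i; rewrite row_mul rowS row0 NE.
  rewrite -scalemxAl linearZ -scalemxAr mulNmx; apply/eqP; rewrite scaler_eq0.
  apply/orP; right; rewrite oppr_eq0; apply/eqP/rowP => j; rewrite (ord1 j).
  by rewrite -dotE [RHS]mxE -(normal i) dotC -g_gram !gEp dotC.
rewrite /shape_trace /conjmx -/S -mulmxA mxtrace_mulC mulmxKpV; last first.
  rewrite eq_row_base; exact/sub_kermxP.
rewrite -christoffel_trace -big_split -sumrN; apply: eq_bigr => i _.
by rewrite SE.
Unshelve. all: by end_near. Qed.

End Coframe.

(** * Coordinates of the half-space and the Clifford representation *)

Section Parts.
Context {R : realType} {n m : nat}.
Local Notation E := 'rV[R]_(n + m + 1).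

Lemma vpart_point (x : 'rV[R]_n) (z : 'rV[R]_m) t : vpart (point x z t) = x.
Proof. by rewrite /vpart /point !row_mxKl. Qed.

Lemma zpart_point (x : 'rV[R]_n) (z : 'rV[R]_m) t : zpart (point x z t) = z.
Proof. by rewrite /zpart /point row_mxKl row_mxKr. Qed.

Lemma tpart_point (x : 'rV[R]_n) (z : 'rV[R]_m) t : tpart (point x z t) = t.
Proof. by rewrite /tpart /point row_mxKr mxE eqxx mulr1n. Qed.

Definition partE := (vpart_point, zpart_point, tpart_point).

Lemma pointE (p : E) : point (vpart p) (zpart p) (tpart p) = p.
Proof.
rewrite /point /vpart /zpart hsubmxK -[RHS]hsubmxK; congr row_mx.
by apply/matrixP => i j; rewrite !ord1 mxE eqxx mulr1n.
Qed.

Lemma vpartD (p q : E) : vpart (p + q) = vpart p + vpart q.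
Proof. by rewrite /vpart !linearD. Qed.
Lemma tpartD (p q : E) : tpart (p + q) = tpart p + tpart q.
Proof. by rewrite /tpart linearD mxE. Qed.
Lemma vpartZ a (p : E) : vpart (a *: p) = a *: vpart p.
Proof. by rewrite /vpart !linearZ. Qed.
Lemma tpartZ a (p : E) : tpart (a *: p) = a * tpart p.
Proof. by rewrite /tpart linearZ mxE. Qed.

Context {V : normedModType R} {x w : V}.

Lemma is_derive_row_mx {k l r} {f : V -> 'M[R]_(r, k)} {g : V -> 'M[R]_(r, l)} {df dg} :
  is_derive x w f df -> is_derive x w g dg ->
  is_derive x w (fun y => row_mx (f y) (g y)) (row_mx df dg).
Proof.
move=> /is_derive_mxP Hf /is_derive_mxP Hg; apply/is_derive_mxP => i j.
rewrite -(@fintype.splitK _ _ j); case: (fintype.split j) => j' /=.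
  by apply: (is_derive_ext (Hf i j')) => [y|]; rewrite row_mxEl.
by apply: (is_derive_ext (Hg i j')) => [y|]; rewrite row_mxEr.
Qed.

Lemma is_derive_col_mx {k l r} {f : V -> 'M[R]_(k, r)} {g : V -> 'M[R]_(l, r)} {df dg} :
  is_derive x w f df -> is_derive x w g dg ->
  is_derive x w (fun y => col_mx (f y) (g y)) (col_mx df dg).
Proof.
move=> /is_derive_mxP Hf /is_derive_mxP Hg; apply/is_derive_mxP => i j.
rewrite -(@fintype.splitK _ _ i); case: (fintype.split i) => i' /=.
  by apply: (is_derive_ext (Hf i' j)) => [y|]; rewrite col_mxEu.
by apply: (is_derive_ext (Hg i' j)) => [y|]; rewrite col_mxEd.
Qed.

Lemma is_derive_scalar_mx {k} {f : V -> R} {df : R} :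
  is_derive x w f df ->
  is_derive x w (fun y => (f y)%:M : 'M[R]_k) (df%:M).
Proof.
move=> Hf; apply/is_derive_mxP => i j.
case: (eqVneq i j) => ij.
  by apply: (is_derive_ext Hf) => [y|]; rewrite mxE ij eqxx mulr1n.
by apply: (is_derive_ext (is_derive_cst (0:R) x w)) => [y|]; rewrite mxE (negPf ij) mulr0n.
Qed.

Lemma is_derive_const {k l} (A : 'M[R]_(k, l)) : is_derive x w (fun=> A) (0 : 'M[R]_(k, l)).
Proof. exact: is_derive_cst. Qed.

Lemma is_derive_constr (a : R) : is_derive x w (fun=> a) (0 : R).
Proof. exact: is_derive_cst. Qed.

Lemma is_derive_point {f : V -> 'rV[R]_n} {g : V -> 'rV[R]_m} {h : V -> R} {df dg dh} :
  is_derive x w f df -> is_derive x w g dg -> is_derive x w h dh ->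
  is_derive x w (fun y => point (f y) (g y) (h y)) (point df dg dh).
Proof.
move=> Hf Hg Hh; apply: is_derive_row_mx; first exact: is_derive_row_mx.
exact: is_derive_scalar_mx.
Qed.

Context {c : V -> E} {X : E}.
Hypothesis Hc : is_derive x w c X.

Lemma is_derive_vpart : is_derive x w (fun y => vpart (c y)) (vpart X).
Proof.
apply/is_derive_mxP => i j.
by apply: (is_derive_ext (is_derive_mxP.1 Hc i (lshift 1 (lshift m j)))) => [y|]; rewrite !mxE.
Qed.

Lemma is_derive_zpart : is_derive x w (fun y => zpart (c y)) (zpart X).
Proof.
apply/is_derive_mxP => i j.
by apply: (is_derive_ext (is_derive_mxP.1 Hc i (lshift 1 (rshift n j)))) => [y|]; rewrite !mxE.
Qed.

Lemma is_derive_tpart : is_derive x w (fun y => tpart (c y)) (tpart X).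
Proof.
by apply: (is_derive_ext (is_derive_mxP.1 Hc 0 (rshift (n + m) 0))) => [y|]; rewrite /tpart !mxE.
Qed.

End Parts.

Section Clifford.
Context {R : realType} {n m : nat} {J : {linear 'rV[R]_m -> 'M[R]_n}}.
Local Notation "[[ U , V ]]" := (bracket J U V) (at level 0).

Lemma bracketE (U V : 'rV[R]_n) k : [[U, V]] 0 k = dot (U *m J (delta_mx 0 k)) V.
Proof. by rewrite mxE. Qed.

Lemma bracketDl (U U' V : 'rV[R]_n) : [[U + U', V]] = [[U, V]] + [[U', V]].
Proof. by apply/rowP => k; rewrite !mxE mulmxDl dotDl. Qed.

Lemma bracketZl a (U V : 'rV[R]_n) : [[a *: U, V]] = a *: [[U, V]].
Proof. by apply/rowP => k; rewrite !mxE -scalemxAl dotZl. Qed.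

Lemma bracketZr a (U V : 'rV[R]_n) : [[U, a *: V]] = a *: [[U, V]].
Proof. by apply/rowP => k; rewrite !mxE dotZr. Qed.

Lemma bracketNl (U V : 'rV[R]_n) : [[- U, V]] = - [[U, V]].
Proof. by rewrite -scaleN1r bracketZl scaleN1r. Qed.

Lemma bracket0l (V : 'rV[R]_n) : [[0, V]] = 0.
Proof. by rewrite -(scale0r 0) bracketZl scale0r. Qed.

Lemma bracket0r (V : 'rV[R]_n) : [[V, 0]] = 0.
Proof. by rewrite -(scale0r 0) bracketZr scale0r. Qed.

Lemma is_derive_bracket {V : normedModType R} {f g : V -> 'rV[R]_n} {x w df dg} :
  is_derive x w f df -> is_derive x w g dg ->
  is_derive x w (fun y => [[f y, g y]]) ([[df, g x]] + [[f x, dg]]).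
Proof.
move=> Hf Hg; apply/is_derive_mxP => i k.
have H := is_derive_dot (is_derive_mulmx Hf (is_derive_const (J (delta_mx 0 k)))) Hg.
by apply: (is_derive_ext H) => [y|]; rewrite !mxE// mulmx0 addr0.
Qed.

Hypothesis HJ : clifford_rep J.

Lemma clifford_norm (U : 'rV[R]_n) Z : dot (U *m J Z) (U *m J Z) = dot Z Z * dot U U.
Proof. by rewrite -!enorm_sqr HJ.2 exprMn. Qed.

Lemma clifford_dot (U V : 'rV[R]_n) Z : dot (U *m J Z) (V *m J Z) = dot Z Z * dot U V.
Proof.
have := clifford_norm (U + V) Z; rewrite mulmxDl !dotDl !dotDr !clifford_norm.
rewrite (dotC (V *m _) (U *m _)) (dotC V U) => H.
by apply: (mulfI (x := 2)) => //; lra.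
Qed.

(** J_Z is an isometry up to the factor |Z|, and its square is - |Z|^2, so
its transpose is its opposite. *)
Lemma clifford_skew (U V : 'rV[R]_n) Z : dot (U *m J Z) V = - dot U (V *m J Z).
Proof.
have [->|Z0] := eqVneq Z 0; first by rewrite linear0 !mulmx0 dot0l dot0r oppr0.
apply: (mulfI (x := dot Z Z)); first by rewrite dot_eq0.
rewrite -clifford_dot -mulmxA HJ.1 mul_mx_scalar dotZl; ring.
Qed.

Lemma clifford_orth (U : 'rV[R]_n) Z : dot (U *m J Z) U = 0.
Proof. by have := clifford_skew U U Z; rewrite (dotC U) => H; lra. Qed.

Lemma clifford_combine_norm a (U : 'rV[R]_n) Z :
  dot (a *: U + U *m J Z) (a *: U + U *m J Z) = (a ^+ 2 + dot Z Z) * dot U U.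
Proof.
rewrite dotDl !dotDr !dotZl !dotZr clifford_norm (dotC U (_ *m _)) clifford_orth.
by ring.
Qed.

Lemma bracketC (U V : 'rV[R]_n) : [[U, V]] = - [[V, U]].
Proof. by apply/rowP => k; rewrite !mxE clifford_skew dotC. Qed.

Lemma bracketxx (U : 'rV[R]_n) : [[U, U]] = 0.
Proof. by apply/rowP => k; rewrite !mxE clifford_orth. Qed.

Lemma clifford_unit (U V : 'rV[R]_n) k :
  dot (U *m J (delta_mx 0 k)) (V *m J (delta_mx 0 k)) = dot U V.
Proof. by rewrite clifford_dot dot_delta mxE !eqxx mul1r. Qed.

(** Summing over i first turns the left-hand side into the sum over an
orthonormal basis Z_k of the products of J_(Z_k) U and J_(Z_k) V. *)
Lemma sum_bracket_dot (U V : 'rV[R]_n) :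
  \sum_(i < n) dot [[U, delta_mx 0 i]] [[V, delta_mx 0 i]] = m%:R * dot U V.
Proof.
rewrite exchange_big /= (eq_bigr (fun=> dot U V)) => [|k _].
  by rewrite sumr_const card_ord mulr_natl.
rewrite -[RHS](clifford_unit U V k); apply: eq_bigr => i _.
by rewrite !bracketE !dot_delta.
Qed.

End Clifford.

(** * The left-invariant coframe *)

Section Metric.
Context {R : realType} {n m : nat} {J : {linear 'rV[R]_m -> 'M[R]_n}}.
Local Notation E := 'rV[R]_(n + m + 1).
Local Notation "[[ U , V ]]" := (bracket J U V) (at level 0).
Local Notation "''e_' i" := (delta_mx 0 i) (at level 8, i at level 2).

(** The matrix of U |-> [V, U], which gives the off-diagonal block of the
coframe at a point with component V. *)
Definition ad_mx (V : 'rV[R]_n) : 'M[R]_(n, m) :=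
  \matrix_(i, k) (V *m J (delta_mx 0 k)) 0 i.

Lemma mul_ad_mx (U V : 'rV[R]_n) : U *m ad_mx V = [[V, U]].
Proof.
by apply/rowP => k; rewrite !mxE; apply: eq_bigr => i _; rewrite !mxE mulrC.
Qed.

(** The differential at q of the left translation by the inverse of q, acting on
row vectors from the right. *)
Definition coframe (q : E) : 'M[R]_(n + m + 1) :=
  block_mx (block_mx (Num.sqrt (tpart q))^-1%:M
                     ((tpart q)^-1 *: (- 2^-1 *: ad_mx (vpart q)))
                     0 ((tpart q)^-1)%:M) 0
           0 ((tpart q)^-1)%:M.

Lemma mul_coframe (q X : E) : X *m coframe q =
  point ((Num.sqrt (tpart q))^-1 *: vpart X)
        ((tpart q)^-1 *: (zpart X - 2^-1 *: [[vpart q, vpart X]]))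
        ((tpart q)^-1 * tpart X).
Proof.
rewrite -{1}(pointE X) /coframe /point !mul_row_block !mulmx0 !addr0 add0r.
rewrite !mul_mx_scalar -!scalemxAr mul_ad_mx; congr (row_mx (row_mx _ _) _).
  by rewrite scalerBr addrC scaleNr scalerN.
by apply/rowP => i; rewrite ord1 !mxE eqxx !mulr1n.
Qed.

Lemma dot_point (x x' : 'rV[R]_n) (z z' : 'rV[R]_m) t t' :
  dot (point x z t) (point x' z' t') = dot x x' + dot z z' + t * t'.
Proof.
rewrite /dot big_split_ord big_split_ord /= big_ord1; congr (_ + _ + _).
- by apply: eq_bigr => i _; rewrite /point !row_mxEl.
- by apply: eq_bigr => i _; rewrite /point !row_mxEl !row_mxEr.
- by rewrite /point !row_mxEr !mxE eqxx !mulr1n.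
Qed.

Lemma near_drspace {p : E} : drspace p -> \near p, drspace p.
Proof.
rewrite /drspace /= => p0.
have tE q : tpart q = q 0 (rshift (n + m) 0) by rewrite /tpart mxE.
have H := @coord_continuous R 1 (n + m + 1) 0 (rshift (n + m) 0) p.
rewrite tE in p0; apply: filterS (cvgr_gt _ H _ p0) => q /=.
by rewrite tE.
Qed.

(** The left translation by a fixed element is an affine map of the
half-space, so its derivative can be read off from the group law. *)
Lemma metricS_coframe {q X Y : E} : drspace q ->
  metricS J q X Y = dot (X *m coframe q) (Y *m coframe q).
Proof.
move=> q0.
have H (Z : E) : is_derive q Z (mulS J (Defs.invS q)) (Z *m coframe q).
  rewrite mul_coframe /mulS /Defs.invS !partE.
  have s0 : Num.sqrt (tpart q) != 0 by rewrite gt_eqF// sqrtr_gt0.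
  have Hid := is_derive_id q Z.
  have Hv := is_derive_vpart Hid.
  have Hz := is_derive_zpart Hid.
  have Ht := is_derive_tpart Hid.
  have Hsc k l (a : R) (M : E -> 'M[R]_(k, l)) dM : is_derive q Z M dM ->
      is_derive q Z (fun y => a *: M y) (a *: dM).
    by move=> HM; apply: (is_derive_ext (is_derive_scale (is_derive_constr a) HM)) => //; rewrite scale0r add0r.
  apply: is_derive_point.
  - apply: (is_derive_ext (is_derive_add (is_derive_const _) (Hsc _ _ _ _ _ Hv))) => //.
    by rewrite add0r sqrtrV// ltW.
  - apply: (is_derive_ext (is_derive_add (is_derive_add (is_derive_const _) (Hsc _ _ _ _ _ Hz))
       (Hsc _ _ _ _ _ (is_derive_bracket (is_derive_const _) Hv)))) => //.
    rewrite add0r bracket0l add0r scalerBr bracketZl; congr (_ + _).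
    rewrite !scalerA -scaleNr; congr (_ *: _).
    rewrite sqrtrV ?ltW// mulrN mulrAC -invfM -expr2 sqr_sqrtr ?ltW//.
by rewrite /metricS (@derive_val _ _ _ _ _ _ _ (H X)) (@derive_val _ _ _ _ _ _ _ (H Y)).
Qed.

Lemma metricSE {q X Y : E} : drspace q -> metricS J q X Y =
  (dot (vpart X) (vpart Y)) / tpart q +
  dot (zpart X - 2^-1 *: [[vpart q, vpart X]]) (zpart Y - 2^-1 *: [[vpart q, vpart Y]])
    / tpart q ^+ 2 + tpart X * tpart Y / tpart q ^+ 2.
Proof.
move=> q0; rewrite metricS_coframe// !mul_coframe dot_point !dotZl !dotZr.
congr (_ + _ + _).
- by rewrite mulrA -invfM -expr2 sqr_sqrtr ?ltW// mulrC.
- by rewrite mulrA -invfM -expr2 mulrC.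
- by rewrite mulrACA -invfM -expr2 mulrC.
Qed.

Definition dcoframe (p X : E) : 'M[R]_(n + m + 1) :=
  let t := tpart p in let s := Num.sqrt t in let r := tpart X in
  block_mx (block_mx (- (r / (2 * s)) / s ^+ 2)%:M
                     ((- r / t ^+ 2) *: (- 2^-1 *: ad_mx (vpart p))
                      + t^-1 *: (- 2^-1 *: ad_mx (vpart X)))
                     0 (- r / t ^+ 2)%:M) 0
           0 (- r / t ^+ 2)%:M.

Lemma is_derive_ad_mx {V : normedModType R} {f : V -> 'rV[R]_n} {x w df} :
  is_derive x w f df -> is_derive x w (fun y => ad_mx (f y)) (ad_mx df).
Proof.
move=> Hf; apply/is_derive_mxP => i k.
have /is_derive_mxP/(_ 0 i) H := is_derive_mulmx Hf (is_derive_const (J 'e_k)).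
apply: (is_derive_ext H) => [y|]; first by rewrite [RHS]mxE.
by rewrite mulmx0 addr0 [RHS]mxE.
Qed.

Lemma is_derive_coframe {V : normedModType R} {c : V -> E} {x w : V} {X : E} :
  drspace (c x) -> is_derive x w c X ->
  is_derive x w (fun y => coframe (c y)) (dcoframe (c x) X).
Proof.
move=> p0 Hid.
have Ht := is_derive_tpart Hid.
have Hti := is_derive_inv Ht (lt0r_neq0 p0).
have s0 : Num.sqrt (tpart (c x)) != 0 by rewrite gt_eqF// sqrtr_gt0.
have Hs := is_derive_inv (is_derive_sqrt Ht p0) s0.
have Hk : is_derive x w (fun y => - 2^-1 *: ad_mx (vpart (c y))) (- 2^-1 *: ad_mx (vpart X)).
  apply: (is_derive_ext (is_derive_scale (is_derive_constr _) (is_derive_ad_mx (is_derive_vpart Hid)))) => //.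
  by rewrite scale0r add0r.
apply: is_derive_col_mx; apply: is_derive_row_mx.
- apply: is_derive_col_mx; apply: is_derive_row_mx.
  + exact: is_derive_scalar_mx Hs.
  + exact: is_derive_scale Hti Hk.
  + exact: is_derive_scalar_mx Hti.
- exact: is_derive_scalar_mx Hti.
Qed.

Lemma dcoframe_lin (p Y : E) : dcoframe p Y = \sum_i Y 0 i *: dcoframe p 'e_i.
Proof.
have dl (a : R) (X Z : E) : dcoframe p (a *: X + Z) = a *: dcoframe p X + dcoframe p Z.
  have adl : ad_mx (a *: vpart X + vpart Z) = a *: ad_mx (vpart X) + ad_mx (vpart Z).
    by apply/matrixP => i k; rewrite mxE mulmxDl -scalemxAl !mxE.
  rewrite /dcoframe !scale_block_mx !add_block_mx !scaler0 !addr0.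
  rewrite vpartD vpartZ tpartD tpartZ adl.
  apply: (f_equal4 block_mx) => //; first apply: (f_equal4 block_mx) => //.
  - by rewrite scale_scalar_mx -raddfD /=; congr (_%:M); ring.
  - by apply/matrixP => i k; rewrite !mxE; ring.
  - by rewrite scale_scalar_mx -raddfD /=; congr (_%:M); ring.
  - by rewrite scale_scalar_mx -raddfD /=; congr (_%:M); ring.
have d0 : dcoframe p 0 = 0.
  by have := dl (-1) 0 0; rewrite scaler0 addr0 scaleN1r addNr.
rewrite [in LHS](row_sum_delta Y) (big_morph (dcoframe p) (id1 := 0) (op1 := +%R)) //.
  by apply: eq_bigr => i _; have := dl (Y 0 i) 'e_i 0; rewrite d0 !addr0.
by move=> X Z; have := dl 1 X Z; rewrite !scale1r.
Qed.

(** Its rows are the left-invariant orthonormal frame. *)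
Definition coframe_inv (q : E) : 'M[R]_(n + m + 1) :=
  block_mx (block_mx (Num.sqrt (tpart q))%:M
                     (Num.sqrt (tpart q) *: (2^-1 *: ad_mx (vpart q)))
                     0 (tpart q)%:M) 0
           0 (tpart q)%:M.

Lemma coframe_invK {q : E} : drspace q -> coframe_inv q *m coframe q = 1%:M.
Proof.
move=> q0; have s0 : Num.sqrt (tpart q) != 0 by rewrite gt_eqF// sqrtr_gt0.
have t0 : tpart q != 0 by rewrite gt_eqF.
rewrite /coframe /coframe_inv !mulmx_block !mulmx0 !mul0mx !addr0 !add0r.
rewrite -!scalar_mxM !divff// !scalar_mx_block; congr block_mx; congr block_mx.
rewrite mul_scalar_mx mul_mx_scalar !scalerA -scalerDl.
by rewrite [X in X *: _](_ : _ = 0) ?scale0r//; ring.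
Qed.

Lemma coframe_unit {q : E} : drspace q -> coframe q \in unitmx.
Proof. by move=> /coframe_invK/mulmx1_unit[]. Qed.

Lemma invmx_coframe {q : E} : drspace q -> invmx (coframe q) = coframe_inv q.
Proof.
move=> q0; rewrite -[LHS]mul1mx -(coframe_invK q0) -mulmxA mulmxV ?mulmx1//.
exact: coframe_unit.
Qed.

(** B^(-1) dB is block triangular, so only the diagonal blocks, of sizes n, m
and 1, contribute. *)
Lemma coframe_trace {p Y : E} : drspace p ->
  \tr (invmx (coframe p) *m dcoframe p Y) =
  - (n%:R / 2 + m%:R + 1) * tpart Y / tpart p.
Proof.
move=> p0; have s0 : 0 < Num.sqrt (tpart p) by rewrite sqrtr_gt0.
rewrite invmx_coframe// /coframe_inv /dcoframe !mulmx_block !mulmx0 !addr0 !mul0mx !add0r.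
rewrite !mxtrace_block -!scalar_mxM !mxtrace_scalar.
have := sqr_sqrtr (ltW p0); set s := Num.sqrt _ in s0 *; move=> <-.
rewrite -[X in X + _ + _]mulr_natl -[X in _ + X + _]mulr_natl -[X in _ + _ + X]mulr_natl.
by field; rewrite gt_eqF.
Qed.

End Metric.

(** * Mean curvature of the levels of an isoparametric function *)

Section Isoparametric.
Context {R : realType} {n m : nat} {J : {linear 'rV[R]_m -> 'M[R]_n}}.
Local Notation E := 'rV[R]_(n + m + 1).
Local Notation "[[ U , V ]]" := (bracket J U V) (at level 0).
Local Notation "''e_' i" := (delta_mx 0 i) (at level 8, i at level 2).

(** The derivative of F along an arbitrary map c, rather than at a point only:
taking c to be the identity identifies the gradient, and taking c to be a curve
gives the chain rule used in the estimate of lengths. *)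
Definition has_gradient (F : E -> R) (W : E -> E) : Prop :=
  forall (V : normedModType R) (c : V -> E) (x w : V) (X : E),
    drspace (c x) -> is_derive x w c X ->
    is_derive x w (fun y => F (c y)) (metricS J (c x) (W (c x)) X).

Definition has_differential (W : E -> E) (dW : E -> E -> E) : Prop :=
  forall (V : normedModType R) (c : V -> E) (x w : V) (X : E),
    drspace (c x) -> is_derive x w c X ->
    is_derive x w (fun y => W (c y)) (dW (c x) X).

(** The last field is the equation for the Laplacian, with the term coming
from the coframe moved to the right-hand side. *)
Record isoparametric (F : E -> R) (W : E -> E) (dW : E -> E -> E)
    (kappa : R) : Prop := Isoparametric {
  iso_grad : has_gradient F W;
  iso_diff : has_differential W dW;
  iso_norm : forall q, drspace q ->
    metricS J q (W q) (W q) = F q ^+ 2 + 4 * kappa * F q;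
  iso_trace : forall q, drspace q ->
    \sum_i dW q 'e_i 0 i = (n%:R / 2 + m%:R + 1) * (tpart (W q) / tpart q + F q)
      + 2 * kappa * (m%:R + 1)
}.

Lemma grad_has_gradient {F W q} : has_gradient F W -> drspace q ->
  grad (metricS J) F q = W q.
Proof.
move=> HF q0; have Bu := coframe_unit (J := J) q0.
have gramE : gram (metricS J) q = coframe (J := J) q *m (coframe (J := J) q)^T.
  by apply: gram_coframe => X Y; exact: metricS_coframe.
have Gu : gram (metricS J) q \in unitmx by rewrite gramE unitmx_mul Bu unitmx_tr.
rewrite /grad; apply: (canLR (mulmxK Gu)); apply/rowP => i.
rewrite mxE (@derive_val _ _ _ _ _ _ _ (HF _ id q 'e_i 'e_i q0 (is_derive_id _ _))).
rewrite metricS_coframe// gramE mulmxA [RHS]mxE -rowE.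
by apply: eq_bigr => k _; rewrite !mxE.
Qed.

(** With a = F^2 + 4 kappa F, the unit normal is a^(-1/2) W, so its divergence
is a^(-1/2) (Laplacian F - a'(F) / 2). *)
Lemma shape_trace_isoparametric {F W dW kappa p} :
  isoparametric F W dW kappa -> drspace p -> grad (metricS J) F p != 0 ->
  0 < F p ^+ 2 + 4 * kappa * F p /\
  shape_trace (metricS J) F p =
    - ((m%:R + n%:R / 2) * F p + 2 * kappa * m%:R)
      / Num.sqrt (F p ^+ 2 + 4 * kappa * F p).
Proof.
move=> [HF HdW HWW trW] p0 gr0.
pose a q := F q ^+ 2 + 4 * kappa * F q.
have Wp0 : W p != 0 by rewrite -(grad_has_gradient HF p0).
have a0 : 0 < a p.
  rewrite /a -HWW// metricS_coframe// lt_def dot_ge0 dot_eq0 andbT.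
  apply: contraNneq Wp0 => H.
  by rewrite -(mulmxK (coframe_unit (J := J) p0) (W p)) H mul0mx.
split=> //.
pose phi q := (Num.sqrt (a q))^-1.
pose N q := phi q *: W q.
have NE q : drspace q -> unit_normal (metricS J) F q = N q.
  by move=> q0; rewrite /unit_normal (grad_has_gradient HF)// HWW.
have nearNE : \near p, unit_normal (metricS J) F p = N p.
  by near=> q; apply: NE; near: q; exact: near_drspace.
have s0 : Num.sqrt (a p) != 0 by rewrite gt_eqF// sqrtr_gt0.
pose b := F p + 2 * kappa.
pose dphi X := - (b / Num.sqrt (a p) ^+ 3) * metricS J p (W p) X.
pose dN X := dphi X *: W p + phi p *: dW p X.
have Hid i := is_derive_id p ('e_i : E).
have Ha i : is_derive p 'e_i a (2 * b * metricS J p (W p) 'e_i).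
  have HF' := HF _ id p 'e_i 'e_i p0 (Hid i).
  apply: (is_derive_ext (is_derive_add (is_derive_sqr HF')
    (is_derive_mul (is_derive_constr (4 * kappa)) HF'))) => //.
  by rewrite /b /=; ring.
have Hphi i : is_derive p 'e_i phi (dphi 'e_i).
  have Hs := is_derive_inv (is_derive_sqrt (Ha i) a0) s0.
  by apply: (is_derive_ext Hs) => //; rewrite /dphi; field.
have HN i : is_derive p 'e_i (unit_normal (metricS J) F) (dN 'e_i).
  apply: (near_eq_is_derive (f := N)).
    by near=> q; apply/esym; near: q.
  exact: is_derive_scale (Hphi i) (HdW _ id p _ _ p0 (Hid i)).
have sa : Num.sqrt (a p) ^+ 2 = a p by rewrite sqr_sqrtr// ltW.
have HgN i : is_derive p 'e_i (fun q => metricS J q (unit_normal (metricS J) F q)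
    (unit_normal (metricS J) F q)) 0.
  apply: (near_eq_is_derive (f := fun q => phi q ^+ 2 * a q)).
    near=> q; have q0 : drspace q by near: q; exact: near_drspace.
    rewrite NE// metricS_coframe// /N -!scalemxAl dotZl dotZr -metricS_coframe// HWW//.
    by rewrite mulrA expr2.
  apply: (is_derive_ext (is_derive_mul (is_derive_sqr (Hphi i)) (Ha i))) => //.
  rewrite /phi /dphi; move: (sa) (s0); set s := Num.sqrt _ => <- s1; by field.
have Np0 : unit_normal (metricS J) F p != 0.
  by rewrite NE// /N scaler_eq0 negb_or Wp0 andbT invr_eq0.
have gE : \near p, forall X Y, metricS J p X Y =
    dot (X *m coframe (J := J) p) (Y *m coframe (J := J) p).
  by near=> q => X Y; apply: metricS_coframe; near: q; exact: near_drspace.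
rewrite (shape_trace_div gE (fun X => is_derive_coframe (c := id) p0 (is_derive_id p X)) (dcoframe_lin p)
  (coframe_unit p0) F dN HN HgN Np0).
rewrite coframe_trace// NE// /N tpartZ.
have -> : \sum_i dN 'e_i 0 i = phi p * \sum_i dW p 'e_i 0 i - b / Num.sqrt (a p).
  under eq_bigr do rewrite /dN 2!mxE [X in _ + X]mxE.
  rewrite big_split /= -mulr_sumr addrC; congr (_ + _).
  under eq_bigr do rewrite /dphi -mulrA.
  rewrite -mulr_sumr.
  have -> : \sum_i metricS J p (W p) 'e_i * W p 0 i = a p.
    rewrite /a -HWW// metricS_coframe// dot_mulmx.
    rewrite -[RHS]/(\sum_i _); apply: eq_bigr => i _.
    rewrite mulrC; congr (_ * _).
    rewrite metricS_coframe// [RHS]mxE -rowE.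
    by apply: eq_bigr => k _; rewrite !mxE.
  move: (sa) (s0); set s := Num.sqrt _ => <- s1; by field.
rewrite trW// /phi /b -/(a p); field.
by rewrite s0 gt_eqF.
Unshelve. all: by end_near. Qed.

End Isoparametric.
Arguments iso_grad {R n m J F W dW kappa}.
Arguments iso_diff {R n m J F W dW kappa}.
Arguments iso_norm {R n m J F W dW kappa}.

(** * The functions of points and of geodesics are isoparametric *)

Section Functions.
Context {R : realType} {n m : nat} {J : {linear 'rV[R]_m -> 'M[R]_n}}.
Hypothesis HJ : clifford_rep J.
Local Notation E := 'rV[R]_(n + m + 1).
Local Notation "[[ U , V ]]" := (bracket J U V) (at level 0).
Local Notation "''e_' i" := (delta_mx 0 i) (at level 8, i at level 2).

Lemma trace_point (f : E -> E) : \sum_i f 'e_i 0 i =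
  \sum_i vpart (f (point 'e_i 0 0)) 0 i +
  \sum_k zpart (f (point 0 'e_k 0)) 0 k + tpart (f (point 0 0 1)).
Proof.
rewrite big_split_ord big_split_ord /= big_ord1; congr (_ + _ + _).
- apply: eq_bigr => i _; rewrite 2!mxE; congr (f _ 0 _).
  by rewrite /point !delta_mx_lshift raddf0.
- apply: eq_bigr => i _; rewrite 2!mxE; congr (f _ 0 _).
  by rewrite /point delta_mx_lshift delta_mx_rshift raddf0.
- rewrite /tpart mxE; congr (f _ 0 _).
  rewrite /point delta_mx_rshift row_mx0; congr row_mx.
  by apply/rowP => i; rewrite !ord1 !mxE.
Qed.

Section Dpt.
Variable x0 : E.
Let W (q : E) := vpart q - vpart x0.
Let u (q : E) := tpart q + tpart x0 + 4^-1 * dot (W q) (W q).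
Let zeta (q : E) := zpart q - zpart x0 + 2^-1 *: [[vpart q, vpart x0]].
Let w (q : E) := u q *: W q + W q *m J (zeta q).

(** With u = t + t_0 + |V - V_0|^2 / 4 and zeta = Z - Z_0 + [V, V_0] / 2, one
has D_x0 = (u^2 + |zeta|^2) / t, and the frame components of the gradient are
(u (V - V_0) + J_zeta (V - V_0)) / sqrt t, 2 zeta and 2 u - D_x0. *)
Definition gradDpt (q : E) : E :=
  point (w q) (2^-1 *: [[vpart q, w q]] + (2 * tpart q) *: zeta q)
        (2 * tpart q * u q - u q ^+ 2 - dot (zeta q) (zeta q)).

Let du (q X : E) := tpart X + 2^-1 * dot (W q) (vpart X).
Let dzeta (X : E) := zpart X + 2^-1 *: [[vpart X, vpart x0]].
Let dw (q X : E) := du q X *: W q + u q *: vpart X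
   + vpart X *m J (zeta q) + W q *m J (dzeta X).

Definition dgradDpt (q X : E) : E :=
  point (dw q X)
    (2^-1 *: ([[vpart X, w q]] + [[vpart q, dw q X]])
     + (2 * tpart X) *: zeta q + (2 * tpart q) *: dzeta X)
    (2 * tpart X * u q + 2 * tpart q * du q X - 2 * u q * du q X
     - 2 * dot (zeta q) (dzeta X)).

Lemma DptE q : Dpt J x0 q = (tpart q)^-1 * (u q ^+ 2 + dot (zeta q) (zeta q)).
Proof.
rewrite /Dpt !enorm_sqr dotZl dotZr -/(W q) mulrA; congr (_ * (_ ^+ 2 + _)).
by rewrite /u; congr (_ + _ * _); field.
Qed.

Section Derivatives.
Context {V : normedModType R} {c : V -> E} {x v : V} {X : E}.
Hypothesis Hc : is_derive x v c X.

Let HW : is_derive x v (fun y => W (c y)) (vpart X).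
Proof.
apply: (is_derive_ext (is_derive_add (is_derive_vpart Hc) (is_derive_const (- vpart x0)))) => //.
by rewrite addr0.
Qed.

Let Hu : is_derive x v (fun y => u (c y)) (du (c x) X).
Proof.
apply: (is_derive_ext (is_derive_add
  (is_derive_add (is_derive_tpart Hc) (is_derive_constr (tpart x0)))
  (is_derive_mul (is_derive_constr 4^-1) (is_derive_dot HW HW)))) => //.
by rewrite /du addr0 mul0r add0r (dotC (vpart X)) -/(W _); congr (_ + _); field.
Qed.

Let Hzeta : is_derive x v (fun y => zeta (c y)) (dzeta X).
Proof.
apply: (is_derive_ext (is_derive_add
  (is_derive_add (is_derive_zpart Hc) (is_derive_const (- zpart x0)))
  (is_derive_scale (is_derive_constr 2^-1)
     (is_derive_bracket (is_derive_vpart Hc) (is_derive_const (vpart x0)))))) => //.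
by rewrite addr0 scale0r add0r bracket0r addr0.
Qed.

Let Hw : is_derive x v (fun y => w (c y)) (dw (c x) X).
Proof.
apply: (is_derive_ext (is_derive_add (is_derive_scale Hu HW)
  (is_derive_mulmx HW (is_derive_linmx J Hzeta)))) => //.
by rewrite /dw !addrA.
Qed.

Lemma is_derive_gradDpt : is_derive x v (fun y => gradDpt (c y)) (dgradDpt (c x) X).
Proof.
have Ht := is_derive_tpart Hc.
have H2t : is_derive x v (fun y => 2 * tpart (c y)) (2 * tpart X).
  apply: (is_derive_ext (is_derive_mul (is_derive_constr 2) Ht)) => //.
  by rewrite mul0r add0r.
apply: is_derive_point.
- exact: Hw.
- apply: (is_derive_ext (is_derive_add
    (is_derive_scale (is_derive_constr 2^-1) (is_derive_bracket (is_derive_vpart Hc) Hw))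
    (is_derive_scale H2t Hzeta))) => //.
  by rewrite scale0r add0r addrA.
- apply: (is_derive_ext (is_derive_add (is_derive_add (is_derive_mul H2t Hu)
    (is_derive_opp (is_derive_sqr Hu))) (is_derive_opp (is_derive_dot Hzeta Hzeta)))) => //.
  by rewrite (dotC (dzeta X)); ring.
Qed.

(** The brackets with V from the coframe and with V_0 from the differential of
zeta combine with the term J_zeta (V - V_0). *)
Lemma is_derive_Dpt : drspace (c x) ->
  is_derive x v (fun y => Dpt J x0 (c y)) (metricS J (c x) (gradDpt (c x)) X).
Proof.
move=> q0; have t0 : tpart (c x) != 0 by rewrite gt_eqF.
have Hti := is_derive_inv (is_derive_tpart Hc) t0.
have HF := is_derive_mul Hti (is_derive_add (is_derive_sqr Hu) (is_derive_dot Hzeta Hzeta)).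
apply: (is_derive_ext HF) => [y|]; first by rewrite DptE.
set q := c x in q0 t0 *.
rewrite metricSE// /gradDpt !partE (addrAC (2^-1 *: _)) subrr add0r.
rewrite dotZl dotDr dotNr dotZr.
rewrite (dotC (dzeta X)).
have -> : dot (w q) (vpart X) = u q * dot (W q) (vpart X) +
    dot (zeta q) [[vpart q, vpart X]] - dot (zeta q) [[vpart x0, vpart X]].
  rewrite dotDl dotZl -bracketP (bracketDl (vpart q)) bracketNl.
  by rewrite !(dotC (zeta q)) dotDl dotNl addrA.
have -> : dot (zeta q) (dzeta X) = dot (zeta q) (zpart X)
    - 2^-1 * dot (zeta q) [[vpart x0, vpart X]].
  by rewrite /dzeta (bracketC HJ (vpart X)) dotDr dotZr dotNr; ring.
rewrite /du; field.
exact: t0.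
Qed.

End Derivatives.

Let dotWW q : dot (W q) (W q) = 4 * (u q - tpart q - tpart x0).
Proof. by rewrite /u; field. Qed.

Lemma gradDpt_norm q : drspace q -> metricS J q (gradDpt q) (gradDpt q) =
  Dpt J x0 q ^+ 2 + 4 * (- tpart x0) * Dpt J x0 q.
Proof.
move=> q0; have t0 : tpart q != 0 by rewrite gt_eqF.
rewrite metricSE// /gradDpt !partE (addrAC (2^-1 *: _)) subrr add0r dotZl dotZr.
rewrite clifford_combine_norm// dotWW DptE; field.
exact: t0.
Qed.

(** Along v, the derivative of J_zeta W contributes - (m / 2) <W, V_0> with
W = V - V_0; along z, the bracket contributes (m / 2) <V, W>.  Together they
give (m / 2) |W|^2 = 2 m (u - t - t_0), and the terms in u and t then cancel
against those of the coframe. *)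
Lemma dgradDpt_trace q : drspace q ->
  \sum_i dgradDpt q 'e_i 0 i =
  (n%:R / 2 + m%:R + 1) * (tpart (gradDpt q) / tpart q + Dpt J x0 q)
  + 2 * (- tpart x0) * (m%:R + 1).
Proof.
move=> q0; have t0 : tpart q != 0 by rewrite gt_eqF.
rewrite trace_point.
have -> : \sum_i vpart (dgradDpt q (point 'e_i 0 0)) 0 i =
    2^-1 * dot (W q) (W q) + n%:R * u q - 2^-1 * (m%:R * dot (W q) (vpart x0)).
  have -> : n%:R * u q = \sum_(i < n) u q by rewrite sumr_const card_ord mulr_natl.
  rewrite -(sum_bracket_dot HJ) -[X in 2^-1 * X]/(\sum_i _) !mulr_sumr -big_split -sumrB /=.
  apply: eq_bigr => i _; rewrite /dgradDpt partE -dot_delta.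
  rewrite /dw /dzeta /du !partE; move: (W q) (u q) (zeta q) (vpart x0) => a b z v0.
  rewrite !dotDl !dotZl clifford_orth// addr0 !add0r.
  rewrite -bracketP dotZr !dot_delta (bracketC HJ 'e_i) dotNr [in 'e_i 0 i]mxE !eqxx.
  by rewrite mulr1; ring.
have -> : \sum_k zpart (dgradDpt q (point 0 'e_k 0)) 0 k =
    m%:R * (2^-1 * dot (vpart q) (W q) + 2 * tpart q).
  have sumC (a : R) : m%:R * a = \sum_(k < m) a by rewrite sumr_const card_ord mulr_natl.
  rewrite sumC; apply: eq_bigr => k _.
  rewrite /dgradDpt partE -dot_delta /dw /dzeta /du !partE.
  move: (W q) (u q) (zeta q) => a b z.
  rewrite !bracket0l !mul0mx !dot0r !scaler0 !addr0 !mulr0 !scale0r !add0r ?addr0.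
  rewrite scale0r add0r dotDl !dotZl [dot (bracket _ _ _) _]dot_delta bracketE (clifford_unit HJ).
  by rewrite dot_delta mxE !eqxx mulr1.
have -> : tpart (dgradDpt q (point 0 0 1)) = 2 * tpart q.
  rewrite /dgradDpt /dzeta /du !partE.
  by rewrite bracket0l scaler0 addr0 !dot0r; ring.
rewrite /gradDpt partE DptE.
have -> : dot (vpart q) (W q) = dot (W q) (W q) + dot (W q) (vpart x0).
  by rewrite -dotDr subrK dotC.
rewrite dotWW; field.
exact: t0.
Qed.

Lemma isoparametric_Dpt : isoparametric (J := J) (Dpt J x0) gradDpt dgradDpt (- tpart x0).
Proof.
split.
- by move=> V c x v X q0 Hc; exact: is_derive_Dpt.
- by move=> V c x v X q0 Hc; exact: is_derive_gradDpt.
- exact: gradDpt_norm.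
- exact: dgradDpt_trace.
Qed.

End Dpt.
Section Dstar.
Variables (a : E) (v : 'rV[R]_n) (s : R).
Let al (q : E) := 2 * s * Num.sqrt (tpart a) - dot (vpart q - vpart a) v.
Let be (q : E) := [[vpart q - vpart a, v]].
Let w (q : E) := (-2) *: (al q *: v + v *m J (be q)).

(** With al = 2 s sqrt t_a - <V - V_a, v> and be = [V - V_a, v], the function
is (al^2 + |be|^2) / t; its gradient has no component along z in the frame. *)
Definition gradDstar (q : E) : E :=
  point (w q) (2^-1 *: [[vpart q, w q]]) (- (al q ^+ 2 + dot (be q) (be q))).

Let dal (X : E) := - dot (vpart X) v.
Let dbe (X : E) := [[vpart X, v]].
Let dw (X : E) := (-2) *: (dal X *: v + v *m J (dbe X)).

Definition dgradDstar (q X : E) : E :=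
  point (dw X) (2^-1 *: ([[vpart X, w q]] + [[vpart q, dw X]]))
    (- (2 * al q * dal X + 2 * dot (be q) (dbe X))).

Lemma DstarE q : Dstar J a v s q = (tpart q)^-1 * (al q ^+ 2 + dot (be q) (be q)).
Proof. by rewrite /Dstar enorm_sqr. Qed.

Section Derivatives.
Context {V : normedModType R} {c : V -> E} {x d : V} {X : E}.
Hypothesis Hc : is_derive x d c X.

Let HW : is_derive x d (fun y => vpart (c y) - vpart a) (vpart X).
Proof.
apply: (is_derive_ext (is_derive_add (is_derive_vpart Hc) (is_derive_const (- vpart a)))) => //.
by rewrite addr0.
Qed.

Let Hal : is_derive x d (fun y => al (c y)) (dal X).
Proof.
apply: (is_derive_ext (is_derive_add (is_derive_constr (2 * s * Num.sqrt (tpart a)))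
  (is_derive_opp (is_derive_dot HW (is_derive_const v))))) => //.
by rewrite dot0r addr0 add0r.
Qed.

Let Hbe : is_derive x d (fun y => be (c y)) (dbe X).
Proof.
apply: (is_derive_ext (is_derive_bracket HW (is_derive_const v))) => //.
by rewrite bracket0r addr0.
Qed.

Let Hw : is_derive x d (fun y => w (c y)) (dw X).
Proof.
apply: (is_derive_ext (is_derive_scale (is_derive_constr (-2))
  (is_derive_add (is_derive_scale Hal (is_derive_const v))
  (is_derive_mulmx (is_derive_const v) (is_derive_linmx J Hbe))))) => //.
by rewrite scale0r scaler0 addr0 mul0mx !add0r.
Qed.

Let Hsum : is_derive x d (fun y => al (c y) ^+ 2 + dot (be (c y)) (be (c y)))
  (2 * al (c x) * dal X + 2 * dot (be (c x)) (dbe X)).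
Proof.
apply: (is_derive_ext (is_derive_add (is_derive_sqr Hal) (is_derive_dot Hbe Hbe))) => //.
by rewrite (dotC (dbe X)); ring.
Qed.

Lemma is_derive_gradDstar :
  is_derive x d (fun y => gradDstar (c y)) (dgradDstar (c x) X).
Proof.
apply: is_derive_point.
- exact: Hw.
- apply: (is_derive_ext (is_derive_scale (is_derive_constr 2^-1)
    (is_derive_bracket (is_derive_vpart Hc) Hw))) => //.
  by rewrite scale0r add0r.
- exact: is_derive_opp Hsum.
Qed.

Lemma is_derive_Dstar : drspace (c x) ->
  is_derive x d (fun y => Dstar J a v s (c y)) (metricS J (c x) (gradDstar (c x)) X).
Proof.
move=> q0; have t0 : tpart (c x) != 0 by rewrite gt_eqF.
have HF := is_derive_mul (is_derive_inv (is_derive_tpart Hc) t0) Hsum.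
apply: (is_derive_ext HF) => [y|]; first by rewrite DstarE.
set q := c x in q0 t0 *.
rewrite metricSE// /gradDstar !partE subrr dot0l.
have -> : dot (w q) (vpart X) = 2 * al q * dal X + 2 * dot (be q) (dbe X).
  rewrite /w /dal /dbe; move: (al q) (be q) => b z.
  rewrite dotZl dotDl dotZl -bracketP (bracketC HJ v) dotNl (dotC z) (dotC v).
  by ring.
by field.
Qed.

End Derivatives.

Lemma gradDstar_norm q : drspace q -> metricS J q (gradDstar q) (gradDstar q) =
  Dstar J a v s q ^+ 2 + 4 * dot v v * Dstar J a v s q.
Proof.
move=> q0; have t0 : tpart q != 0 by rewrite gt_eqF.
rewrite metricSE// /gradDstar !partE subrr dot0l dotZl dotZr clifford_combine_norm//.
by rewrite DstarE; field.
Qed.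

Lemma dgradDstar_trace q : drspace q ->
  \sum_i dgradDstar q 'e_i 0 i =
  (n%:R / 2 + m%:R + 1) * (tpart (gradDstar q) / tpart q + Dstar J a v s q)
  + 2 * dot v v * (m%:R + 1).
Proof.
move=> q0; have t0 : tpart q != 0 by rewrite gt_eqF.
rewrite trace_point.
have -> : \sum_i vpart (dgradDstar q (point 'e_i 0 0)) 0 i =
    2 * dot v v + 2 * (m%:R * dot v v).
  rewrite -(sum_bracket_dot HJ) -[X in 2 * X + _]/(\sum_i _) !mulr_sumr -big_split /=.
  apply: eq_bigr => i _; rewrite /dgradDstar partE -dot_delta.
  rewrite /dw /dal /dbe !partE dotZl dotDl dotZl -bracketP (dotC 'e_i) dot_delta.
  by rewrite (bracketC HJ 'e_i) dotNr; ring.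
have -> : \sum_k zpart (dgradDstar q (point 0 'e_k 0)) 0 k = 0.
  apply: big1 => k _; rewrite /dgradDstar partE /dw /dal /dbe !partE.
  by rewrite !bracket0l dot0l oppr0 scale0r linear0 mulmx0 addr0 scaler0 bracket0r addr0 scaler0 mxE.
have -> : tpart (dgradDstar q (point 0 0 1)) = 0.
  by rewrite /dgradDstar partE /dal /dbe !partE bracket0l dot0l dot0r; ring.
by rewrite /gradDstar partE DstarE; field.
Qed.

Lemma isoparametric_Dstar :
  isoparametric (J := J) (Dstar J a v s) gradDstar dgradDstar (dot v v).
Proof.
split.
- by move=> V c x d X q0 Hc; exact: is_derive_Dstar.
- by move=> V c x d X q0 Hc; exact: is_derive_gradDstar.
- exact: gradDstar_norm.
- exact: dgradDstar_trace.
Qed.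

End Dstar.
End Functions.

(** * Lower bound on the length of a curve *)

Section RealAnalysis.
Context {R : realType}.

Lemma is_derive_continuous {f : R -> R} {u df : R} :
  is_derive u 1 f df -> {for u, continuous f}.
Proof.
move=> [fu _]; apply: differentiable_continuous.
exact: (derivable1_diffP f u).1.
Qed.

(** Differentiability is required at the end points as well, so that the
boundary limits need no separate hypothesis. *)
Lemma Rintegral_FTC (G g : R -> R) :
  (forall u : R, 0 <= u <= 1 -> is_derive u 1 G (g u)) ->
  (forall u : R, 0 <= u <= 1 -> {for u, continuous g}) ->
  \int[lebesgue_measure]_(u in `[0, 1]) g u = G 1 - G 0.
Proof.
move=> HG Hg.
have gc : {within `[0, 1], continuous g}.
  by apply: continuous_in_subspaceT => u /[!inE] /=; rewrite in_itv; exact: Hg.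
have Gc (u : R) : 0 <= u <= 1 -> {for u, continuous G}.
  by move=> /HG; exact: is_derive_continuous.
rewrite /Rintegral (@continuous_FTC2 _ g G 0 1) //.
- split.
  + move=> u; rewrite in_itv /= => /andP[u0 u1].
    by have [] : is_derive u 1 G (g u) by apply: HG; rewrite (ltW u0) (ltW u1).
  + by apply: cvg_at_right_filter; apply: Gc; rewrite lexx ler01.
  + by apply: cvg_at_left_filter; apply: Gc; rewrite lexx ler01.
- move=> u; rewrite in_itv /= => /andP[u0 u1].
  by rewrite derive1E; apply: derive_val; apply: HG; rewrite (ltW u0) (ltW u1).
Qed.

Lemma integrable_unit_itv (g : R -> R) :
  (forall u : R, 0 <= u <= 1 -> {for u, continuous g}) ->
  lebesgue_measure.-integrable `[0, 1] (EFin \o g).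
Proof.
move=> Hg; apply: continuous_compact_integrable; first exact: segment_compact.
by apply: continuous_in_subspaceT => u /[!inE] /=; rewrite in_itv; exact: Hg.
Qed.

(** Continuity of each entry, for which products of matrices reduce to sums
and products of real functions. *)
Definition entry_continuous {k l} (M : R -> 'M[R]_(k, l)) (u : R) :=
  forall i j, {for u, continuous (fun s => M s i j)}.

Lemma continuous_fsum {l : nat} {h : 'I_l -> R -> R} {u : R} :
  (forall i, {for u, continuous (h i)}) ->
  {for u, continuous (fun s => \sum_i h i s)}.
Proof.
move=> H; have -> : (fun s => \sum_i h i s) = \sum_i h i.
  by apply/funext => s; rewrite fct_sumE.
elim/big_ind : _ => //; first exact: cst_continuous.
by move=> f g; exact: continuousD.
Qed.

Lemma entry_continuous_mulmx {k l r} {M : R -> 'M[R]_(k, l)} {N : R -> 'M[R]_(l, r)} {u} :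
  entry_continuous M u -> entry_continuous N u ->
  entry_continuous (fun s => M s *m N s) u.
Proof.
move=> HM HN i j.
have -> : (fun s => (M s *m N s) i j) = fun s => \sum_h M s i h * N s h j.
  by apply/funext => s; rewrite mxE.
by apply: continuous_fsum => h; exact: continuousM.
Qed.

Lemma continuous_dot {k} {f g : R -> 'rV[R]_k} {u} :
  entry_continuous f u -> entry_continuous g u ->
  {for u, continuous (fun s => dot (f s) (g s))}.
Proof.
by move=> Hf Hg; apply: continuous_fsum => h; exact: continuousM.
Qed.

Lemma is_derive_entry {k l} {M : R -> 'M[R]_(k, l)} {u : R} {dM : 'M[R]_(k, l)} :
  is_derive u 1 M dM -> entry_continuous M u.
Proof.
by move=> /is_derive_mxP H i j; exact: is_derive_continuous (H i j).
Qed.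

Lemma continuous_entry {k l} {M : R -> 'M[R]_(k, l)} {u : R} :
  {for u, continuous M} -> entry_continuous M u.
Proof.
move=> H i j; apply: (@continuous_comp _ _ _ M (fun A => A i j) u) => //.
exact: coord_continuous.
Qed.

End RealAnalysis.

Section LowerBound.
Context {R : realType} {n m : nat} {J : {linear 'rV[R]_m -> 'M[R]_n}}.
Local Notation E := 'rV[R]_(n + m + 1).
Context {F : E -> R} {W : E -> E} {dW : E -> E -> E} {kappa k : R}.
Hypothesis HF : isoparametric (J := J) F W dW kappa.
Let y (q : E) := F q + 2 * kappa.
Hypothesis k0 : 0 < k.
Hypothesis kE : k ^+ 2 = (2 * kappa) ^+ 2.
Hypothesis ky : forall q, drspace q -> k <= y q.

(** The function ln (y + sqrt (y^2 - k^2)) has a gradient of length 1, but is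
singular where y = k, in particular at the end point q.  It is replaced by
ln (y + sqrt (y^2 - k^2 + e^2)), smooth with gradient of length at most 1, and e
tends to 0 at the end. *)
Lemma curve_length_ge p q c : curve_from_to drspace p q c -> y q = k ->
  y p + Num.sqrt (y p ^+ 2 - k ^+ 2) <=
  expR (curve_length (metricS J) c) * k.
Proof.
move=> [cd cc cM c0 c1] yq; set L := curve_length _ _.
have c' (u : R) : is_derive u 1 c (derive1 c u).
  by rewrite derive1E; exact: derivableP.
have ysq (u : R) : 0 <= u <= 1 -> 0 <= y (c u) ^+ 2 - k ^+ 2.
  move=> /cM cu; rewrite subr_ge0 ler_sqr ?nnegrE ?ky ?ltW//.
  exact: lt_le_trans (ky _ cu).
pose B u := coframe (J := J) (c u).
pose speed u := Num.sqrt (dot (derive1 c u *m B u) (derive1 c u *m B u)).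
pose dy u := dot (W (c u) *m B u) (derive1 c u *m B u).
have Bc (u : R) : 0 <= u <= 1 -> entry_continuous B u.
  move=> /cM cu; apply: (is_derive_entry (dM := dcoframe (J := J) (c u) (derive1 c u))).
  exact: is_derive_coframe.
have c'c (u : R) : 0 <= u <= 1 -> entry_continuous (fun u => derive1 c u *m B u) u.
  by move=> u01; apply: entry_continuous_mulmx; [apply: continuous_entry; exact: cc|exact: Bc].
have dyc (u : R) : 0 <= u <= 1 -> {for u, continuous dy}.
  move=> u01; apply: continuous_dot; last exact: c'c.
  apply: entry_continuous_mulmx; last exact: Bc.
  exact: is_derive_entry (iso_diff HF _ _ _ _ _ (cM _ u01) (c' u)).
have speedc (u : R) : 0 <= u <= 1 -> {for u, continuous speed}.
  move=> u01; apply: (@continuous_comp _ _ _ (fun u => dot (derive1 c u *m B u) (derive1 c u *m B u))).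
    by apply: continuous_dot; exact: c'c.
  exact: sqrt_continuous.
have Dy (u : R) : 0 <= u <= 1 -> is_derive u 1 (fun u => y (c u)) (dy u).
  move=> u01; have := iso_grad HF _ _ _ _ _ (cM _ u01) (c' u).
  rewrite metricS_coframe; last exact: cM.
  move=> H; apply: (is_derive_ext (is_derive_add H (is_derive_constr (2 * kappa)))) => //.
  by rewrite addr0.
have LE : L = \int[lebesgue_measure]_(u in `[0, 1]) speed u.
  apply: eq_Rintegral => u; rewrite inE /= in_itv /= => u01.
  by rewrite /speed metricS_coframe//; exact: cM.
have dy_speed (u : R) : 0 <= u <= 1 ->
    `|dy u| <= Num.sqrt (y (c u) ^+ 2 - k ^+ 2) * speed u.
  move=> u01; rewrite -sqrtrM ?ysq// -sqrtr_sqr ler_wsqrtr//.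
  apply: le_trans (dot_CS _ _) _; rewrite -metricS_coframe; last exact: cM.
  rewrite (iso_norm HF); last exact: cM.
  by rewrite le_eqVlt; apply/orP; left; apply/eqP; rewrite kE /y; ring.
have main e : 0 < e -> y p + Num.sqrt (y p ^+ 2 - k ^+ 2 + e ^+ 2) <=
    expR L * (k + e).
  move=> e0.
  pose z u := y (c u) ^+ 2 - k ^+ 2 + e ^+ 2.
  have z0 (u : R) : 0 <= u <= 1 -> 0 < z u.
    by move=> u01; rewrite /z ltr_wpDl ?ysq// exprn_gt0.
  pose G u := ln (y (c u) + Num.sqrt (z u)).
  have Gpos (u : R) : 0 <= u <= 1 -> 0 < y (c u) + Num.sqrt (z u).
    move=> u01; rewrite ltr_wpDr ?sqrtr_ge0//.
    exact: lt_le_trans (ky _ (cM _ u01)).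
  have Dz (u : R) : 0 <= u <= 1 -> is_derive u 1 z (2 * y (c u) * dy u).
    move=> u01; apply: (is_derive_ext (is_derive_add (is_derive_add
      (is_derive_sqr (Dy u u01)) (is_derive_constr (- k ^+ 2)))
      (is_derive_constr (e ^+ 2)))) => //.
    by rewrite !addr0.
  have Dsz (u : R) : 0 <= u <= 1 ->
      is_derive u 1 (fun u => Num.sqrt (z u)) (2 * y (c u) * dy u / (2 * Num.sqrt (z u))).
    by move=> u01; exact: is_derive_sqrt (Dz u u01) (z0 u u01).
  have sz0 (u : R) : 0 <= u <= 1 -> 0 < Num.sqrt (z u) by move=> u01; rewrite sqrtr_gt0 z0.
  have DG (u : R) : 0 <= u <= 1 -> is_derive u 1 G (dy u / Num.sqrt (z u)).
    move=> u01; have Hln := is_derive1_ln (Gpos u u01).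
    apply: (is_derive_ext (is_derive_chain (is_derive_add (Dy u u01) (Dsz u u01)) Hln)) => //.
    field; rewrite !gt_eqF ?sz0// ?Gpos//.
  have dGc (u : R) : 0 <= u <= 1 -> {for u, continuous (fun u => dy u / Num.sqrt (z u))}.
    move=> u01; apply: (@continuousM _ _ dy (fun u => (Num.sqrt (z u))^-1)).
      exact: dyc.
    apply: continuousV; first by rewrite gt_eqF ?sz0.
    exact: is_derive_continuous (Dsz u u01).
  have : - L <= G 1 - G 0.
    rewrite -(Rintegral_FTC _ _ DG dGc) LE -[X in - X]mul1r -mulNr -RintegralZl//; last first.
      exact: integrable_unit_itv.
    apply: le_Rintegral => //.
    - apply: integrable_unit_itv => u u01.
      by apply: (@continuousM _ _ (cst (-1)) speed); [exact: cst_continuous|exact: speedc].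
    - exact: integrable_unit_itv.
    - move=> u /=; rewrite in_itv /= => u01.
      rewrite mulN1r lerNl -mulNr ler_pdivrMr ?sz0//.
      apply: le_trans (ler_norm _) _; rewrite normrN.
      apply: le_trans (dy_speed u u01) _; rewrite mulrC ler_wpM2l ?sqrtr_ge0//.
      by rewrite ler_wsqrtr// /z lerDl sqr_ge0.
  have i0 : 0 <= (0:R) <= 1 by rewrite lexx ler01.
  have i1 : 0 <= (1:R) <= 1 by rewrite lexx ler01.
  have G1 : G 1 = ln (k + e).
    by rewrite /G /z c1 yq subrr add0r sqrtr_sqr gtr0_norm.
  move=> H; have {H} : G 0 <= L + G 1 by lra.
  rewrite -ler_expR expRD G1 [expR (ln _)]lnK; last by rewrite posrE addr_gt0.
  by rewrite /G lnK ?posrE ?Gpos// /z c0.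
set A := y p + _; rewrite leNgt; apply/negP => AL.
(* This e makes exp L * (k + e) the midpoint of exp L * k and A. *)
pose e := (A - expR L * k) / (2 * expR L).
have eL0 := expR_gt0 L.
have e0 : 0 < e by rewrite divr_gt0 ?subr_gt0// mulr_gt0.
have := main e e0; rewrite leNgt => /negP; apply.
have -> : expR L * (k + e) = (A + expR L * k) / 2.
  by rewrite /e; field; rewrite gt_eqF.
apply: (@lt_le_trans _ _ A); first by lra.
by rewrite lerD2l ler_wsqrtr// lerDl sqr_ge0.
Qed.

End LowerBound.

(** * Distances to points and to focal submanifolds *)

Section Hyperbolic.
Context {R : realType}.
Implicit Types r : R.

Lemma cosh_sinh r : cosh r ^+ 2 - sinh r ^+ 2 = 1.
Proof.
have H : expR r * expR (- r) = 1 by rewrite -expRD subrr expR0.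
by rewrite /cosh /sinh -[RHS]H; field.
Qed.

Lemma cosh_double r : cosh r = cosh (r / 2) ^+ 2 + sinh (r / 2) ^+ 2.
Proof.
rewrite /cosh /sinh.
have -> : expR r = expR (r / 2) ^+ 2 by rewrite -expRM_natl; congr expR; field.
have -> : expR (- r) = expR (- (r / 2)) ^+ 2 by rewrite -expRM_natl; congr expR; field.
by field.
Qed.

Lemma cosh_gt0 r : 0 < cosh r.
Proof. by rewrite divr_gt0// addr_gt0// expR_gt0. Qed.

Lemma sinh_ge0 r : 0 <= r -> 0 <= sinh r.
Proof. by move=> r0; rewrite divr_ge0// subr_ge0 ler_expR; lra. Qed.

Lemma sinh_gt0 r : 0 < r -> 0 < sinh r.
Proof. by move=> r0; rewrite divr_gt0// subr_gt0 ltr_expR; lra. Qed.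

Lemma cosh_surj (Y : R) : 1 <= Y -> exists2 r, 0 <= r & cosh r = Y.
Proof.
move=> Y1; pose s := Num.sqrt (Y ^+ 2 - 1).
have Y2 : 0 <= Y ^+ 2 - 1 by nra.
have ss : s ^+ 2 = Y ^+ 2 - 1 by rewrite sqr_sqrtr.
have s0 : 0 <= s := sqrtr_ge0 _.
have Ys : 0 < Y + s by lra.
exists (ln (Y + s)); first by apply: ln_ge0; lra.
rewrite /cosh expRN lnK ?posrE//.
have -> : (Y + s)^-1 = Y - s.
  by apply: (mulfI (lt0r_neq0 Ys)); rewrite divff ?gt_eqF//; nra.
by field.
Qed.

End Hyperbolic.

Section Distance.
Context {R : realType} {n m : nat} {J : {linear 'rV[R]_m -> 'M[R]_n}}.
Local Notation E := 'rV[R]_(n + m + 1).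

Lemma curve_of_derivatives (p q : E) (c dc : R -> E) :
  (forall u : R, is_derive u 1 c (dc u)) ->
  (forall u : R, derivable dc u 1) ->
  (forall u, 0 <= u <= 1 -> drspace (c u)) -> c 0 = p -> c 1 = q ->
  curve_from_to drspace p q c /\ derive1 c = dc.
Proof.
move=> Hc Hdc cM c0 c1.
have E1 : derive1 c = dc by apply/funext => u; rewrite derive1E; apply: derive_val.
split; last exact: E1.
split; [by move=> u; case: (Hc u)| |exact: cM|exact: c0|exact: c1].
rewrite E1 => u; apply: differentiable_continuous.
exact: (derivable1_diffP dc u).1.
Qed.

(** The half-space is convex, so segments will do.  The infimum of an empty set
of lengths would be 0, hence lower bounds on distances depend on this. *)
Lemma exists_curve (p q : E) : drspace p -> drspace q ->
  exists c, curve_from_to drspace p q c.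
Proof.
move=> p0 q0; pose c (u : R) := p + u *: (q - p).
exists c; apply: (curve_of_derivatives p q c (fun=> q - p) _ _ _ _ _).1.
- move=> u; have Hid := is_derive_id u (1 : R).
  apply: (is_derive_ext (is_derive_add (is_derive_const p)
    (is_derive_scale Hid (is_derive_const (q - p))))) => //.
  by rewrite add0r scaler0 addr0 scale1r.
- by move=> u; exact: derivable_cst.
- move=> u /andP[u0 u1]; rewrite /drspace /c /= tpartD tpartZ tpartD -scaleN1r tpartZ.
  move: p0 q0; rewrite /drspace /=; move: (tpart p) (tpart q) => a b a0 b0.
  have [->|u0'] := eqVneq u 0; first by rewrite mul0r addr0.
  have : 0 < u by rewrite lt_def u0' u0.
  by nra.
- by rewrite /c scale0r addr0.
- by rewrite /c scale1r addrC subrK.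
Qed.

Lemma curve_length_ge0 (g : E -> E -> E -> R) c : 0 <= curve_length g c.
Proof. by apply: Rintegral_ge0 => u _; exact: sqrtr_ge0. Qed.

Lemma dist_le_curve (p q : E) c : curve_from_to drspace p q c ->
  dist (metricS J) drspace p q <= curve_length (metricS J) c.
Proof.
move=> cP; apply: ge_inf; last by exists c.
by exists 0 => _ [c' _ <-]; exact: curve_length_ge0.
Qed.

Context {F : E -> R} {W : E -> E} {dW : E -> E -> E} {kappa k : R}.
Hypothesis HF : isoparametric (J := J) F W dW kappa.
Hypothesis k0 : 0 < k.
Hypothesis kE : k ^+ 2 = (2 * kappa) ^+ 2.
Hypothesis ky : forall q, drspace q -> k <= F q + 2 * kappa.

Lemma dist_ge p q r : drspace p -> drspace q -> 0 <= r ->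
  F p + 2 * kappa = k * cosh r -> F q + 2 * kappa = k ->
  r <= dist (metricS J) drspace p q.
Proof.
move=> p0 q0 r0 yp yq; apply: lb_le_inf.
  by have [c cP] := exists_curve p q p0 q0; exists (curve_length (metricS J) c); exists c.
move=> _ [c cP <-].
have := curve_length_ge HF k0 kE ky p q c cP yq; rewrite yp.
have -> : (k * cosh r) ^+ 2 - k ^+ 2 = (k * sinh r) ^+ 2.
  have -> : (k * cosh r) ^+ 2 = k ^+ 2 * (1 + sinh r ^+ 2).
    by rewrite exprMn; congr (_ * _); have := cosh_sinh r; lra.
  by ring.
rewrite sqrtr_sqr ger0_norm; last by rewrite mulr_ge0 ?sinh_ge0// ltW.
have -> : k * cosh r + k * sinh r = expR r * k by rewrite /cosh /sinh; field.
by rewrite ler_pM2r// ler_expR.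
Qed.

Lemma dist_focal p q r c : drspace p -> drspace q -> 0 <= r ->
  F p + 2 * kappa = k * cosh r -> F q + 2 * kappa = k ->
  curve_from_to drspace p q c -> curve_length (metricS J) c = r ->
  dist (metricS J) drspace p q = r.
Proof.
move=> p0 q0 r0 yp yq cP cL; apply/eqP; rewrite eq_le dist_ge// andbT.
by rewrite -[X in _ <= X]cL dist_le_curve.
Qed.

Lemma dist_set_focal p q r c (A : set E) : drspace p -> A q -> 0 <= r ->
  (forall a, A a -> drspace a /\ F a + 2 * kappa = k) ->
  F p + 2 * kappa = k * cosh r ->
  curve_from_to drspace p q c -> curve_length (metricS J) c = r ->
  dist_set (metricS J) drspace p A = r.
Proof.
move=> p0 Aq r0 HA yp cP cL.
have lb : lbound [set dist (metricS J) drspace p q | q in A] r.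
  by move=> _ [a /HA[a0 ya] <-]; exact: dist_ge.
apply/eqP; rewrite eq_le; apply/andP; split; last first.
  by apply: lb_le_inf => //; exists (dist (metricS J) drspace p q); exists q.
apply: (@le_trans _ _ (dist (metricS J) drspace p q)).
  by apply: ge_inf; [exists r|exists q].
by rewrite -[X in _ <= X]cL dist_le_curve.
Qed.

End Distance.

(** * Minimizing geodesics *)

Section Curves.
Context {R : realType} {n m : nat} {J : {linear 'rV[R]_m -> 'M[R]_n}}.
Local Notation E := 'rV[R]_(n + m + 1).
Local Notation "[[ U , V ]]" := (bracket J U V) (at level 0).

Lemma constant_speed_curve (p q : E) (c dc : R -> E) (r : R) : 0 <= r ->
  (forall u : R, is_derive u 1 c (dc u)) ->
  (forall u : R, derivable dc u 1) ->
  (forall u, drspace (c u)) -> c 0 = p -> c 1 = q ->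
  (forall u, metricS J (c u) (dc u) (dc u) = r ^+ 2) ->
  curve_from_to drspace p q c /\ curve_length (metricS J) c = r.
Proof.
move=> r0 Hc Hdc cM c0 c1 speed.
have [cP c'E] := curve_of_derivatives p q c dc Hc Hdc (fun u _ => cM u) c0 c1.
split=> //; rewrite /curve_length c'E.
under eq_Rintegral do rewrite speed sqrtr_sqr ger0_norm//.
rewrite Rintegral_cst//= lebesgue_measure_itv /= lte_fin ltr01.
by rewrite oppr0 adde0 mulr1.
Qed.

Lemma is_derive_expR_decay (r u : R) :
  is_derive u 1 (fun u => expR (r * (1 - u))) (- r * expR (r * (1 - u))).
Proof.
have Hid := is_derive_id u (1 : R).
have H : is_derive u 1 (fun u => r * (1 - u)) (- r).
  apply: (is_derive_ext (is_derive_mul (is_derive_constr r)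
    (is_derive_add (is_derive_constr 1) (is_derive_opp Hid)))) => //.
  by rewrite mul0r !add0r mulrN1.
by apply: (is_derive_chain H); exact: is_derive_expR.
Qed.

(** The geodesic t |-> exp (t A), left translated: constant speed in ln t. *)
Lemma vertical_curve (V : 'rV[R]_n) (Z : 'rV[R]_m) (t r : R) : 0 < t -> 0 <= r ->
  exists c, curve_from_to drspace (point V Z (t * expR r) : E) (point V Z t) c /\
    curve_length (metricS J) c = r.
Proof.
move=> t0 r0; pose e u := expR (r * (1 - u)).
pose c u : E := point V Z (t * e u).
pose dc u : E := point 0 0 (t * (- r * e u)).
exists c; apply: (constant_speed_curve _ _ c dc) => //.
- move=> u; apply: is_derive_point.
  apply: (is_derive_ext (is_derive_mul (is_derive_constr t) (is_derive_expR_decay r u))) => //.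
  by rewrite mul0r add0r.
- move=> u.
  have He := is_derive_mul (is_derive_constr t)
    (is_derive_mul (is_derive_constr (- r)) (is_derive_expR_decay r u)).
  by have [] := is_derive_point (is_derive_const (0 : 'rV[R]_n))
    (is_derive_const (0 : 'rV[R]_m)) He.
- by move=> u; rewrite /drspace /= partE mulr_gt0// expR_gt0.
- by rewrite /c /e subr0 mulr1.
- by rewrite /c /e subrr mulr0 expR0 mulr1.
- move=> u; have e0 : e u != 0 by rewrite gt_eqF// expR_gt0.
  rewrite metricSE /drspace /= ?partE ?mulr_gt0 ?expR_gt0//.
  rewrite bracket0r scaler0 subr0 !dot0l; field.
  by rewrite e0 gt_eqF.
Qed.

Hypothesis HJ : clifford_rep J.

(** In the totally geodesic hyperbolic plane through (V1, 0, 1) tangent to v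
and A, with curvature -1/4, the geodesic orthogonal to the vertical line is
x = 2 tanh (sigma / 2), t = 1 / cosh^2 (sigma / 2), where x is the coordinate
along v / |v|.  It is run through from sigma = r to sigma = 0, and written
rationally in e = exp sigma. *)
Lemma half_circle_curve (V1 v : 'rV[R]_n) (r : R) : v != 0 -> 0 <= r ->
  exists c (p : E), [/\ curve_from_to drspace p (point V1 0 1) c,
    curve_length (metricS J) c = r &
    exists xi, vpart p = V1 + xi *: v /\
      xi ^+ 2 * dot v v = 2 * (cosh r - 1) * tpart p].
Proof.
move=> v0 r0; pose e u := expR (r * (1 - u)); pose N := enorm v.
have vv : 0 < dot v v by rewrite lt_def dot_ge0 dot_eq0 v0.
have N0 : 0 < N by rewrite sqrtr_gt0.
have NN : N ^+ 2 = dot v v by rewrite enorm_sqr.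
have e0 u : 0 < e u := expR_gt0 _.
have De (u : R) : is_derive u 1 e (- r * e u) := is_derive_expR_decay r u.
have e1 u : 0 < e u + 1 by rewrite addr_gt0.
(* That is x / |v| with x = 2 (e - 1) / (e + 1). *)
pose xi u := 2 / N - 4 / N * (e u + 1)^-1.
pose dxi u := - (4 / N * (r * e u * ((e u + 1)^-1) ^+ 2)).
pose t u := 4 * (e u * (e u + 1)^-1 ^+ 2).
pose dt u := 4 * (r * (e u * (e u - 1) * (e u + 1)^-1 ^+ 3)).
pose w := [[V1, v]].
pose c u : E := point (V1 + xi u *: v) ((2^-1 * xi u) *: w) (t u).
pose dc u : E := point (dxi u *: v) ((2^-1 * dxi u) *: w) (dt u).
have c0 u : drspace (c u).
  by rewrite /drspace /= partE !mulr_gt0// invr_gt0.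
have De1 (u : R) : is_derive u 1 (fun u => (e u + 1)^-1) (r * e u * ((e u + 1)^-1) ^+ 2).
  have H := is_derive_add (De u) (is_derive_constr (1 : R)).
  apply: (is_derive_ext (is_derive_inv H _)) => //; first by rewrite gt_eqF.
  by field; rewrite gt_eqF.
have Dxi (u : R) : is_derive u 1 xi (dxi u).
  apply: (is_derive_ext (is_derive_add (is_derive_constr (2 / N))
    (is_derive_opp (is_derive_mul (is_derive_constr (4 / N)) (De1 u))))) => //.
  by rewrite mul0r !add0r.
have Dt (u : R) : is_derive u 1 t (dt u).
  apply: (is_derive_ext (is_derive_mul (is_derive_constr 4)
    (is_derive_mul (De u) (is_derive_sqr (De1 u))))) => //.
  by rewrite /dt; field; rewrite gt_eqF.
have Ddxi (u : R) : exists d, is_derive u 1 dxi d.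
  eexists; exact: (is_derive_opp (is_derive_mul (is_derive_constr (4 / N))
    (is_derive_mul (is_derive_mul (is_derive_constr r) (De u)) (is_derive_sqr (De1 u))))).
have Ddt (u : R) : exists d, is_derive u 1 dt d.
  have H3 := is_derive_mul (De1 u) (is_derive_sqr (De1 u)).
  eexists; apply: (is_derive_ext (is_derive_mul (is_derive_constr 4) (is_derive_mul
    (is_derive_constr r) (is_derive_mul (is_derive_mul (De u)
      (is_derive_add (De u) (is_derive_constr (-1)))) H3)))) => //.
have cE : curve_from_to drspace (c 0) (point V1 0 1) c /\ curve_length (metricS J) c = r.
  apply: (constant_speed_curve _ _ c dc) => //.
  - move=> u; apply: is_derive_point.
    + apply: (is_derive_ext (is_derive_add (is_derive_const V1)
        (is_derive_scale (Dxi u) (is_derive_const v)))) => //.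
      by rewrite scaler0 addr0 add0r.
    + apply: (is_derive_ext (is_derive_scale (is_derive_mul (is_derive_constr 2^-1) (Dxi u))
         (is_derive_const w))) => //.
      by rewrite scaler0 addr0 mul0r add0r.
  - move=> u; have [a Ha] := Ddxi u; have [b Hb] := Ddt u.
    by have [] := is_derive_point (is_derive_scale Ha (is_derive_const v))
      (is_derive_scale (is_derive_mul (is_derive_constr 2^-1) Ha) (is_derive_const w)) Hb.
  - rewrite /c /xi /t /e subrr mulr0 expR0.
    have -> : 2 / N - 4 / N * (1 + 1)^-1 = 0 by field; rewrite gt_eqF.
    by rewrite mulr0 !scale0r addr0; congr point; field.
  - move=> u; rewrite metricSE// /c /dc !partE.
    rewrite bracketDl !bracketZl !bracketZr bracketxx// !scaler0 addr0 scalerA subrr dot0l.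
    rewrite dotZl dotZr -NN /dxi /dt /t.
    by field; rewrite !gt_eqF.
exists c, (c 0); split; [exact: cE.1|exact: cE.2|exists (xi 0)].
rewrite /c !partE; split=> //; rewrite -NN /xi /t /cosh.
have -> : e 0 = expR r by rewrite /e subr0 mulr1.
have er : 0 < expR r := expR_gt0 _.
rewrite expRN; field.
by rewrite !gt_eqF// addr_gt0.
Qed.

End Curves.

(** * Radii of the level sets and the mean curvature *)

Section Formulas.
Context {R : realType} (n m : nat).
Implicit Types F kappa r : R.

(** Here F = - 4 kappa cosh^2 (r / 2) and F + 4 kappa = - 4 kappa sinh^2 (r / 2). *)
Lemma sphere_formula F kappa r : kappa < 0 -> 0 < r ->
  F + 2 * kappa = 2 * `|kappa| * cosh r ->
  - ((m%:R + n%:R / 2) * F + 2 * kappa * m%:R) / Num.sqrt (F ^+ 2 + 4 * kappa * F) =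
  - ((m + n)%:R / 2) * coth (r / 2) - m%:R / 2 * tanh (r / 2).
Proof.
move=> k0 r0; rewrite ltr0_norm// cosh_double => Fr.
have S0 : 0 < sinh (r / 2) by apply: sinh_gt0; rewrite divr_gt0.
have C0 := cosh_gt0 (r / 2); have CS := cosh_sinh (r / 2).
rewrite /coth /tanh natrD; move: Fr CS C0 S0.
move: (sinh _) (cosh _) => S C Fr CS C0 S0.
have {Fr} FE : F = - 4 * kappa * C ^+ 2 by nra.
have -> : F ^+ 2 + 4 * kappa * F = (- 4 * kappa * C * S) ^+ 2.
  have S2 : S ^+ 2 = C ^+ 2 - 1 by lra.
  by rewrite exprMn S2 FE; ring.
rewrite sqrtr_sqr gtr0_norm; last by do 2!(apply: mulr_gt0 => //); lra.
have -> : 2 * kappa * m%:R = 2 * kappa * m%:R * (C ^+ 2 - S ^+ 2) by rewrite CS mulr1.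
rewrite FE; field.
by rewrite (gt_eqF C0) (gt_eqF S0) (lt_eqF k0).
Qed.

(** Here F = 4 kappa sinh^2 (r / 2) and F + 4 kappa = 4 kappa cosh^2 (r / 2). *)
Lemma tube_formula F kappa r : 0 < kappa -> 0 < r ->
  F + 2 * kappa = 2 * `|kappa| * cosh r ->
  - ((m%:R + n%:R / 2) * F + 2 * kappa * m%:R) / Num.sqrt (F ^+ 2 + 4 * kappa * F) =
  - ((m + n)%:R / 2) * tanh (r / 2) - m%:R / 2 * coth (r / 2).
Proof.
move=> k0 r0; rewrite gtr0_norm// cosh_double => Fr.
have S0 : 0 < sinh (r / 2) by apply: sinh_gt0; rewrite divr_gt0.
have C0 := cosh_gt0 (r / 2); have CS := cosh_sinh (r / 2).
rewrite /coth /tanh natrD; move: Fr CS C0 S0.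
move: (sinh _) (cosh _) => S C Fr CS C0 S0.
have {Fr} FE : F = 4 * kappa * S ^+ 2 by nra.
have -> : F ^+ 2 + 4 * kappa * F = (4 * kappa * C * S) ^+ 2.
  have C2 : C ^+ 2 = 1 + S ^+ 2 by lra.
  by rewrite (mulrAC _ C) exprMn C2 FE; ring.
rewrite sqrtr_sqr gtr0_norm; last by rewrite !mulr_gt0.
have -> : 2 * kappa * m%:R = 2 * kappa * m%:R * (C ^+ 2 - S ^+ 2) by rewrite CS mulr1.
rewrite FE; field.
by rewrite !gt_eqF.
Qed.

Lemma horosphere_formula F : 0 <= F -> 0 < F ^+ 2 + 4 * 0 * F ->
  - ((m%:R + n%:R / 2) * F + 2 * 0 * m%:R) / Num.sqrt (F ^+ 2 + 4 * 0 * F) =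
  - (m%:R + n%:R / 2).
Proof.
move=> F0; rewrite !mulr0 !mul0r !addr0 => F2.
have F1 : F != 0 by apply: contraTneq F2 => ->; rewrite expr0n ltxx.
by rewrite sqrtr_sqr ger0_norm// mulNr mulfK.
Qed.

End Formulas.

Section Radii.
Context {R : realType} {n m : nat} {J : {linear 'rV[R]_m -> 'M[R]_n}}.
Hypothesis HJ : clifford_rep J.
Local Notation E := 'rV[R]_(n + m + 1).

Lemma Dpt_ge0 (x0 q : E) : drspace q -> 0 <= Dpt J x0 q.
Proof.
by move=> q0; rewrite /Dpt mulr_ge0 ?addr_ge0 ?sqr_ge0// invr_ge0 ltW.
Qed.

Lemma Dstar_ge0 (a q : E) v s : drspace q -> 0 <= Dstar J a v s q.
Proof.
by move=> q0; rewrite /Dstar mulr_ge0 ?addr_ge0 ?sqr_ge0// invr_ge0 ltW.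
Qed.

(** For t_0 > 0 this is the inequality (t + t_0)^2 >= 4 t t_0. *)
Lemma Dpt_ge (x0 q : E) : drspace q ->
  2 * `|tpart x0| <= Dpt J x0 q + 2 * (- tpart x0).
Proof.
move=> q0; have [t0|t0] := ltP (tpart x0) 0.
  by rewrite ltr0_norm// lerDr Dpt_ge0.
suff : 4 * tpart x0 <= Dpt J x0 q by rewrite ger0_norm//; lra.
rewrite /Dpt ler_pdivlMl//.
move: q0; rewrite /drspace /=.
set b := enorm (2^-1 *: _) ^+ 2; set z := enorm _ ^+ 2; move: (tpart q) => t q0.
have b0 : 0 <= b by exact: sqr_ge0.
have z0 : 0 <= z by exact: sqr_ge0.
rewrite -subr_ge0.
have -> : (t + tpart x0 + b) ^+ 2 + z - t * (4 * tpart x0) =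
  (t - tpart x0) ^+ 2 + 2 * (b * (t + tpart x0)) + b ^+ 2 + z by ring.
have H : 0 <= b * (t + tpart x0) by rewrite mulr_ge0// addr_ge0// ltW.
by have := sqr_ge0 (t - tpart x0); have := sqr_ge0 b; lra.
Qed.

Lemma Dpt_axis (x0 : E) t :
  Dpt J x0 (point (vpart x0) (zpart x0) t) = t^-1 * (t + tpart x0) ^+ 2.
Proof.
by rewrite /Dpt !enorm_sqr !partE !subrr !scaler0 dot0l bracketxx// scaler0 !addr0 dot0l addr0.
Qed.

(** The point of the level set is taken on the vertical line through x_0.  For
t_0 > 0 the end of the curve is x_0, and for t_0 < 0 it is the point of the
focal submanifold with the same components in v and z as x_0. *)
Lemma Dpt_radius (x0 p : E) : tpart x0 != 0 -> drspace p ->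
  exists r, exists p0, exists c, [/\ 0 <= r,
    Dpt J x0 p + 2 * (- tpart x0) = 2 * `|tpart x0| * cosh r,
    level drspace (Dpt J x0) (Dpt J x0 p) p0,
    curve_from_to drspace p0 (point (vpart x0) (zpart x0) `|tpart x0|) c &
    curve_length (metricS J) c = r].
Proof.
move=> t0 p0; have k0 : 0 < 2 * `|tpart x0| by rewrite mulr_gt0// normr_gt0.
have [r r0 rE] : exists2 r, 0 <= r &
    cosh r = (Dpt J x0 p + 2 * (- tpart x0)) / (2 * `|tpart x0|).
  by apply: cosh_surj; rewrite ler_pdivlMr// mul1r Dpt_ge.
have [|c [cP cL]] := @vertical_curve _ _ _ J (vpart x0) (zpart x0) `|tpart x0| r _ r0.
  by rewrite normr_gt0.
exists r, (point (vpart x0) (zpart x0) (`|tpart x0| * expR r)), c; split=> //.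
  by rewrite rE [RHS]mulrC divfK// gt_eqF.
have yE : Dpt J x0 p = 2 * `|tpart x0| * cosh r + 2 * tpart x0.
  by rewrite rE [X in X + _]mulrC divfK ?gt_eqF//; ring.
split; first by rewrite /drspace /= partE mulr_gt0 ?normr_gt0// expR_gt0.
rewrite Dpt_axis yE /cosh expRN; have er := expR_gt0 r.
have [tp|tn] := ltP 0 (tpart x0).
  by rewrite gtr0_norm//; field; rewrite t0 gt_eqF.
by rewrite ler0_norm//; field; rewrite t0 gt_eqF.
Qed.

Lemma Dstar_ge (a q : E) v s : drspace q ->
  2 * `|dot v v| <= Dstar J a v s q + 2 * dot v v.
Proof. by move=> q0; rewrite ger0_norm ?dot_ge0// lerDr Dstar_ge0. Qed.

Lemma Fstar_Dstar (a q : E) v s : Fstar J a v s q -> Dstar J a v s q = 0.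
Proof.
move=> [_ be0 al0]; rewrite /Dstar al0 subrr expr0n be0 enorm_sqr dot0l.
by rewrite addr0 mulr0.
Qed.

(** The half circle leaves the focal submanifold orthogonally, from the point
V1 whose difference with V_a is the multiple of v solving its equations. *)
Lemma Dstar_radius (a p : E) v s : v != 0 -> drspace p ->
  exists r, exists p0, exists q0, exists c, [/\ 0 <= r,
    Dstar J a v s p + 2 * dot v v = 2 * `|dot v v| * cosh r,
    level drspace (Dstar J a v s) (Dstar J a v s p) p0, Fstar J a v s q0 &
    curve_from_to drspace p0 q0 c /\ curve_length (metricS J) c = r].
Proof.
move=> v0 p0; have vv : 0 < dot v v by rewrite lt_def dot_ge0 dot_eq0 v0.
rewrite gtr0_norm//.
have k0 : 0 < 2 * dot v v by rewrite mulr_gt0.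
have [r r0 rE] : exists2 r, 0 <= r &
    cosh r = (Dstar J a v s p + 2 * dot v v) / (2 * dot v v).
  apply: cosh_surj; rewrite ler_pdivlMr// mul1r.
  by have := Dstar_ge a p v s p0; rewrite gtr0_norm.
have yE : Dstar J a v s p + 2 * dot v v = 2 * dot v v * cosh r.
  by rewrite rE [RHS]mulrC divfK// gt_eqF.
pose l := 2 * s * Num.sqrt (tpart a).
(* The solution of <V - V_a, v> = l on the line V_a + R v, where moreover [V - V_a, v] = 0. *)
pose V1 := vpart a + (l / dot v v) *: v.
have [c [q [cP cL [xi [qV qxi]]]]] := half_circle_curve HJ V1 v r v0 r0.
have q0 : drspace q by case: cP => _ _ cM <- _; apply: cM; rewrite lexx ler01.
exists r, q, (point V1 0 1), c; split=> //.
  have dV : vpart q - vpart a = (l / dot v v + xi) *: v.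
    by rewrite qV /V1 scalerDl -!addrA addrC -!addrA addNr addr0.
  split=> //; rewrite [LHS]/Dstar enorm_sqr dV -/l bracketZl bracketxx// scaler0 dot0l.
  rewrite dotZl mulrDl divfK ?gt_eqF// addr0.
  have -> : (l - (l + xi * dot v v)) ^+ 2 = dot v v * (xi ^+ 2 * dot v v) by ring.
  have -> : Dstar J a v s p = 2 * dot v v * (cosh r - 1) by rewrite mulrBr mulr1 -yE; ring.
  by rewrite qxi; field; rewrite gt_eqF.
rewrite /Fstar /= !partE -/l /V1 (addrC (vpart a)) addrK; split.
- by rewrite /drspace /= partE.
- by rewrite bracketZl bracketxx// scaler0.
- by rewrite dotZl divfK// gt_eqF.
Qed.

Lemma focal_scale (kappa : R) : kappa != 0 ->
  0 < 2 * `|kappa| /\ (2 * `|kappa|) ^+ 2 = (2 * kappa) ^+ 2.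
Proof.
by move=> k0; rewrite mulr_gt0 ?normr_gt0// !exprMn real_normK ?num_real.
Qed.

Lemma sphere_radius (x0 p : E) c r : 0 < tpart x0 ->
  level drspace (Dpt J x0) c = sphere (metricS J) drspace x0 r ->
  level drspace (Dpt J x0) c p ->
  Dpt J x0 p + 2 * (- tpart x0) = 2 * `|- tpart x0| * cosh r.
Proof.
move=> t0 Lr [p0 pc]; rewrite normrN.
have [k0 kE] := focal_scale (tpart x0) (lt0r_neq0 t0).
have [r' [p1 [g [r'0 yr Lp1 gP gL]]]] := Dpt_radius x0 p (lt0r_neq0 t0) p0.
rewrite yr; congr (_ * cosh _).
have yp1 : Dpt J x0 p1 + 2 * - tpart x0 = 2 * `|tpart x0| * cosh r' by case: Lp1 => _ ->.
have /= := Lp1; rewrite pc Lr => -[p10 <-].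
rewrite (gtr0_norm t0) pointE in gP.
apply/esym; apply: (dist_focal (isoparametric_Dpt HJ x0) k0 _ (@Dpt_ge x0) p1 x0 r' g) => //.
  by rewrite kE mulrN sqrrN.
have := Dpt_axis x0 (tpart x0); rewrite pointE gtr0_norm// => ->; field.
exact: lt0r_neq0.
Qed.

Lemma tube_radius_pt (x0 p : E) c r : tpart x0 < 0 ->
  level drspace (Dpt J x0) c = tube (metricS J) drspace (Fpt J x0) r ->
  level drspace (Dpt J x0) c p ->
  Dpt J x0 p + 2 * (- tpart x0) = 2 * `|- tpart x0| * cosh r.
Proof.
move=> t0 Lr [p0 pc]; rewrite normrN.
have [k0 kE] := focal_scale (tpart x0) (ltr0_neq0 t0).
have [r' [p1 [g [r'0 yr Lp1 gP gL]]]] := Dpt_radius x0 p (ltr0_neq0 t0) p0.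
rewrite yr; congr (_ * cosh _).
have yp1 : Dpt J x0 p1 + 2 * - tpart x0 = 2 * `|tpart x0| * cosh r' by case: Lp1 => _ ->.
have /= := Lp1; rewrite pc Lr => -[p10 <-].
rewrite (ltr0_norm t0) in gP.
apply/esym; apply: (dist_set_focal (isoparametric_Dpt HJ x0) k0 _ (@Dpt_ge x0) p1 _ r' g _ p10 _ r'0 _ yp1 gP gL).
- by rewrite kE mulrN sqrrN.
- split; first by rewrite /drspace /= partE oppr_gt0.
  by rewrite Dpt_axis addNr expr0n mulr0.
- by move=> b [b0 ->]; split=> //; rewrite add0r ltr0_norm.
Qed.

Lemma tube_radius_star (a p : E) v s c r : v != 0 ->
  level drspace (Dstar J a v s) c = tube (metricS J) drspace (Fstar J a v s) r ->
  level drspace (Dstar J a v s) c p ->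
  Dstar J a v s p + 2 * dot v v = 2 * `|dot v v| * cosh r.
Proof.
move=> v0 Lr [p0 pc]; have vv0 : dot v v != 0 by rewrite dot_eq0.
have [k0 kE] := focal_scale (dot v v) vv0.
have [r' [p1 [q0 [g [r'0 yr Lp1 Fq0 [gP gL]]]]]] := Dstar_radius a p v s v0 p0.
rewrite yr; congr (_ * cosh _).
have yp1 : Dstar J a v s p1 + 2 * dot v v = 2 * `|dot v v| * cosh r' by case: Lp1 => _ ->.
have /= := Lp1; rewrite pc Lr => -[p10 <-].
apply/esym; apply: (dist_set_focal (isoparametric_Dstar HJ a v s) k0 kE
  (fun q => Dstar_ge a q v s) p1 q0 r' g _ p10 Fq0 r'0 _ yp1 gP gL) => b Fb.
split; first by case: Fb.
by rewrite Fstar_Dstar// add0r ger0_norm// dot_ge0.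
Qed.

End Radii.

Theorem theorem12p1 (R : realType) (n m : nat)
  (J : {linear 'rV[R]_m -> 'M[R]_n}) (HJ : clifford_rep J) :
  [/\
    (* spheres: F = D_x0, t_0 > 0 *)
    forall (x0 : 'rV[R]_(n + m + 1)) (c r : R),
      0 < tpart x0 -> 0 < r ->
      regular_value (metricS J) drspace (Dpt J x0) c ->
      level drspace (Dpt J x0) c = sphere (metricS J) drspace x0 r ->
      forall p, level drspace (Dpt J x0) c p ->
        shape_trace (metricS J) (Dpt J x0) p =
          - ((m + n)%:R / 2) * coth (r / 2) - m%:R / 2 * tanh (r / 2),
    (* horospheres: F = D_x0, t_0 = 0 *)
    forall (x0 : 'rV[R]_(n + m + 1)) (c : R),
      tpart x0 = 0 ->
      regular_value (metricS J) drspace (Dpt J x0) c ->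
      forall p, level drspace (Dpt J x0) c p ->
        shape_trace (metricS J) (Dpt J x0) p = - (m%:R + n%:R / 2),
    (* horospheres: F = D_*^eta, v = 0 *)
    forall (a : 'rV[R]_(n + m + 1)) (v : 'rV[R]_n) (s c : R),
      drspace a -> enorm v ^+ 2 + s ^+ 2 = 1 -> v = 0 ->
      regular_value (metricS J) drspace (Dstar J a v s) c ->
      forall p, level drspace (Dstar J a v s) c p ->
        shape_trace (metricS J) (Dstar J a v s) p = - (m%:R + n%:R / 2),
    (* tubes about F_x0: F = D_x0, t_0 < 0 *)
    forall (x0 : 'rV[R]_(n + m + 1)) (c r : R),
      tpart x0 < 0 -> 0 < r ->
      regular_value (metricS J) drspace (Dpt J x0) c ->
      level drspace (Dpt J x0) c
        = tube (metricS J) drspace (Fpt J x0) r ->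
      forall p, level drspace (Dpt J x0) c p ->
        shape_trace (metricS J) (Dpt J x0) p =
          - ((m + n)%:R / 2) * tanh (r / 2) - m%:R / 2 * coth (r / 2) &
    (* tubes about F_*^eta: F = D_*^eta, v <> 0 *)
    forall (a : 'rV[R]_(n + m + 1)) (v : 'rV[R]_n) (s c r : R),
      drspace a -> enorm v ^+ 2 + s ^+ 2 = 1 -> v <> 0 -> 0 < r ->
      regular_value (metricS J) drspace (Dstar J a v s) c ->
      level drspace (Dstar J a v s) c
        = tube (metricS J) drspace (Fstar J a v s) r ->
      forall p, level drspace (Dstar J a v s) c p ->
        shape_trace (metricS J) (Dstar J a v s) p =
          - ((m + n)%:R / 2) * tanh (r / 2) - m%:R / 2 * coth (r / 2)].
Proof.
split.
- move=> x0 c r t0 r0 reg Lr p Lp; have [p0 pc] := Lp.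
  have iso := isoparametric_Dpt HJ x0.
  have [_ ->] := shape_trace_isoparametric iso p0 (reg p Lp).
  apply: sphere_formula; rewrite ?oppr_lt0//.
  exact: sphere_radius Lr Lp.
- move=> x0 c t0 reg p Lp; have [p0 pc] := Lp.
  have iso := isoparametric_Dpt HJ x0; rewrite t0 oppr0 in iso.
  have [a0 ->] := shape_trace_isoparametric iso p0 (reg p Lp).
  by apply: horosphere_formula a0; exact: Dpt_ge0.
- move=> a v s c a0 _ v0 reg p Lp; have [p0 pc] := Lp.
  have iso := isoparametric_Dstar HJ a v s.
  have [] := shape_trace_isoparametric iso p0 (reg p Lp).
  have -> : dot v v = 0 by rewrite v0 dot0l.
  by move=> F0 ->; apply: horosphere_formula F0; exact: Dstar_ge0.
- move=> x0 c r t0 r0 reg Lr p Lp; have [p0 pc] := Lp.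
  have iso := isoparametric_Dpt HJ x0.
  have [_ ->] := shape_trace_isoparametric iso p0 (reg p Lp).
  apply: tube_formula; rewrite ?oppr_gt0//.
  exact: tube_radius_pt Lr Lp.
- move=> a v s c r a0 _ /eqP v0 r0 reg Lr p Lp; have [p0 pc] := Lp.
  have iso := isoparametric_Dstar HJ a v s.
  have [_ ->] := shape_trace_isoparametric iso p0 (reg p Lp).
  apply: tube_formula => //; first by rewrite lt_def dot_ge0 dot_eq0 v0.
  exact: tube_radius_star Lr Lp.
Qed.
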